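(* Let $n>2$ and let $\varkappa=(x_1,\dots,x_N)\in\mathbb{R}^{2N}$ be a $D_n$-symmetric configuration with a symmetric mass (vorticity) distribution, whose point set $X$ is a ring system of type $(a,b,c)$, and suppose $\varkappa$ is a relative equilibrium, either of the planar $N$-body problem with exponent $\gamma\neq-1$ or of the $N$-vortex problem ($\gamma=-1$). Let $A=M^{-1}D\nabla U_\gamma(\varkappa)$ in the $N$-body case and $A=M^{-1}D\nabla H_{-1}(\varkappa)$ in the $N$-vortex case. Then $\mathbb{R}^{2N}$ is a direct sum of subspaces, each invariant under both $A$ and $J$, and correspondingly the stability polynomial $P_\gamma(\lambda)$ is the product of the determinants of the restrictions to these subspaces of the operator whose determinant defines $P_\gamma(\lambda)$. The resulting factors are polynomials (in $\lambda^2$ in the $N$-body case, in $\lambda$ in the $N$-vortex case) as follows: (i) one (if $n$ is odd) or two (if $n$ is even) polynomials of degree $2(b+2c)$; (ii) $\frac{n-3}{2}$ (if $n$ is odd) or $\frac n2-2$ (if $n$ is even) polynomials of degree $4(b+2c)$; (iii) one polynomial of degree $2(a+2b+4c)$. (In each case the dimension of the corresponding invariant subspace equals the degree of the factor.) Moreover, the polynomial in (iii) has a factor of degree two arising from the two-dimensional $A$- and $J$-invariant subspace of translations $\{(v,\dots,v): v\in\mathbb{R}^2\}$, and one of the polynomials of degree $2(b+2c)$ in (i) has a factor of degree two arising from the two-dimensional $A$- and $J$-invariant subspace spanned by $\varkappa$ and $J\varkappa$. (Degrees are again in $\lambda^2$ for the $N$-body case and in $\lambda$ for the $N$-vortex 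case.)
   Context: Dihedral action: $D_n=\langle r,s\rangle$ is the dihedral group with $2n$ elements, acting on $\mathbb{R}^2$ by the standard representation $\sigma$: $\sigma(r)$ is the rotation by $2\pi/n$ about the origin and $\sigma(s)$ is a reflection in a line through the origin. A set $X\subset\mathbb{R}^2$ is $D_n$-symmetric if $\sigma(g)X=X$ for all $g\in D_n$. A configuration $\varkappa=(x_1,\dots,x_N)\in(\mathbb{R}^2)^N=\mathbb{R}^{2N}$ with distinct $x_i$ is $D_n$-symmetric if $X=\{x_1,\dots,x_N\}$ is; then $g\cdot x_j=x_{g(j)}$ defines an action on indices. Ring systems: a finite $D_n$-symmetric set $X$ with at least two points is a ring system of type $(a,b,c)$ if it is the disjoint union of $a\in\{0,1\}$ one-point orbits (the barycenter $O=0$), $b$ regular $n$-gons (vertex sets that are orbits of $n$ points, centred at $O$) and $c$ semiregular $2n$-gons (orbits of $2n$ points), with $b+c>0$. Masses: $m_1,\dots,m_N\in\mathbb{R}\setminus\{0\}$; the distribution is symmetric if $m_{g(i)}=m_i$ for all $g\in D_n$ and all $i$. $M=\mathrm{diag}(m_1,m_1,\dots,m_N,m_N)$; $J$ is the $2N\times 2N$ block-diagonal matrix with $N$ diagonal blocks $\begin{pmatrix}0&-1\\1&0\end{pmatrix}$. Potentials: $U_\gamma(\varkappa)=\frac1{2\gamma+2}\sum_{i<j}m_im_j\|x_i-x_j\|^{2\gamma+2}$ for $\gamma\in\mathbb{R}\setminus\{-1\}$, and $H_{-1}(\varkappa)=-\sum_{i<j}m_im_j\ln\|x_i-x_j\|$.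 Relative equilibria: fix $\omega\in\mathbb{R}\setminus\{0\}$. $\varkappa$ is a relative equilibrium of the $N$-body problem if $\nabla U_\gamma(\varkappa)=\omega^2M\varkappa$, and of the $N$-vortex problem if $\nabla H_{-1}(\varkappa)=-\omega M\varkappa$. Stability polynomials: $P_\gamma(\lambda)=\det\big(M^{-1}D\nabla U_\gamma(\varkappa)+(\lambda^2-\omega^2)I_{2N}+2\lambda\omega J\big)$ for $\gamma\ne-1$, and $P_{-1}(\lambda)=\det\big(M^{-1}D\nabla H_{-1}(\varkappa)+\omega I_{2N}+\lambda J\big)$. *)

(* Defs.v *)
From HB Require Import structures.
From mathcomp Require Import all_boot all_order all_algebra fingroup.
From mathcomp Require extremal.
From mathcomp Require Import mxrepresentation.
From mathcomp Require Import mxtens.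
From mathcomp Require Import all_classical all_reals all_analysis.

Set Implicit Arguments.
Unset Strict Implicit.
Unset Printing Implicit Defensive.

Import Order.TTheory GRing.Theory Num.Theory.
Import numFieldNormedType.Exports.

Local Open Scope classical_set_scope.
Local Open Scope ring_scope.

(* R^{2N} is 'cV[R]_(N * 2); the coordinates of the i-th point are those of    *)
(* index 2 * i and 2 * i + 1, i.e., mxtens_index (i, k) with k < 2.            *)

Section Plane.
Context {R : realType}.

Definition mx2 (a b c d : R) : 'M[R]_2 :=
  \matrix_(i, j) if i == 0 then (if j == 0 then a else b)
                 else (if j == 0 then c else d).

Definition rotation (t : R) : 'M[R]_2 := mx2 (cos t) (- sin t) (sin t) (cos t).

(* Reflection in the line spanned by (cos t, sin t). *)
Definition reflection (t : R) : 'M[R]_2 :=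
  mx2 (cos (2 * t)) (sin (2 * t)) (sin (2 * t)) (- cos (2 * t)).

(* The sup norm is the library's norm on matrices, hence this definition. *)
Definition enorm (v : 'cV[R]_2) : R := Num.sqrt (\sum_k v k 0 ^+ 2).

End Plane.

(* The dihedral group with 2n elements ('D_m has order m). The notation of the *)
(* library is not used because it clashes with the one for derivatives.        *)
Notation Dih n := (extremal.dihedral_gtype n.*2).

Section Dihedral.
Context {R : realType} {n : nat}.

(* A representation acts on columns by left multiplication. *)
Implicit Types (sigma : mx_representation R [set: Dih n]%SET 2).
Implicit Types (X : set 'cV[R]_2) (p : 'cV[R]_2).

Definition standard_representation sigma : Prop :=
  exists r s : Dih n,
    [/\ <<[set r; s]%SET>>%g = [set: Dih n]%SET,
        sigma r = rotation (2 * pi / n%:R)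
      & exists t, sigma s = reflection t].

Definition dihedral_symmetric sigma X : Prop :=
  forall g, [set sigma g *m p | p in X] = X.

Definition dihedral_orbit sigma p : set 'cV[R]_2 :=
  range (fun g => sigma g *m p).

Definition ring_card {a b c : nat} (k : 'I_a + 'I_b + 'I_c) : nat :=
  match k with inl (inl _) => 1%N | inl (inr _) => n | inr _ => n.*2 end.

Definition ring_system sigma (a b c : nat) X : Prop :=
  [/\ finite_set X, dihedral_symmetric sigma X & (`I_2 #<= X)%card] /\
  [/\ (a <= 1)%N, (0 < b + c)%N &
    exists C : 'I_a + 'I_b + 'I_c -> set 'cV[R]_2,
      [/\ forall k, exists p, C k = dihedral_orbit sigma p,
          forall k, (C k #= `I_(ring_card k))%card,
          trivIset setT C
        & X = \bigcup_k C k]].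

End Dihedral.

Section Configurations.
Context {R : realType} {N : nat}.
Implicit Types (x y : 'cV[R]_(N * 2)) (m : 'I_N -> R).

Definition pos y (i : 'I_N) : 'cV[R]_2 := \col_k y (mxtens_index (i, k)) 0.

Definition translation (v : 'cV[R]_2) : 'cV[R]_(N * 2) :=
  \col_k v (mxtens_unindex k).2 0.

Definition symmetric_masses {n} (sigma : mx_representation R [set: Dih n]%SET 2)
    x m : Prop :=
  forall g i j, sigma g *m pos x i = pos x j -> m j = m i.

(* Kronecker products: the left factor is indexed by the N points, the right   *)
(* one by the two coordinates.                                                 *)
Definition massmx m : 'M[R]_(N * 2) := diag_mx (\row_i m i) *t 1%:M.
Definition Jmx : 'M[R]_(N * 2) := 1%:M *t mx2 0 (-1) 1 0.

Definition gradient (f : 'cV[R]_(N * 2) -> R) y : 'cV[R]_(N * 2) :=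
  \col_k 'D_(delta_mx k 0) f y.

Definition hessian (f : 'cV[R]_(N * 2) -> R) y : 'M[R]_(N * 2) :=
  \matrix_(k, l) 'D_(delta_mx l 0) (fun z => gradient f z k 0) y.

Definition body_potential (gamma : R) m y : R :=
  (2 * gamma + 2)^-1 *
    \sum_(i < N) \sum_(j < N | (i < j)%N)
      m i * m j * (enorm (pos y i - pos y j) `^ (2 * gamma + 2)).

Definition vortex_potential m y : R :=
  - \sum_(i < N) \sum_(j < N | (i < j)%N)
      m i * m j * ln (enorm (pos y i - pos y j)).

(* From here on gamma = -1 stands for the N-vortex problem and any other value *)
(* of gamma for the N-body problem.                                            *)
Definition potential (gamma : R) m : 'cV[R]_(N * 2) -> R :=
  if gamma == -1 then vortex_potential m else body_potential gamma m.

Definition relative_equilibrium (gamma omega : R) m x : Prop :=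
  gradient (potential gamma m) x =
    (if gamma == -1 then - omega else omega ^+ 2) *: (massmx m *m x).

Definition Amx (gamma : R) m x : 'M[R]_(N * 2) :=
  invmx (massmx m) *m hessian (potential gamma m) x.

End Configurations.

Section Stability.
Context {R : realType}.

(* The operator whose determinant defines the stability polynomial, built on   *)
(* any pair (A, J) of square matrices; 'X stands for lambda.                   *)
Definition stability_operator (gamma omega : R) d (A J : 'M[R]_d) :
    'M[{poly R}]_d :=
  if gamma == -1 then
    map_mx polyC A + (omega%:P)%:M + 'X *: map_mx polyC J
  else
    map_mx polyC A + ('X^2 - (omega ^+ 2)%:P)%:M
      + ((2 * omega)%:P * 'X) *: map_mx polyC J.

Definition stability_poly (gamma omega : R) d (A J : 'M[R]_d) : {poly R} :=
  \det (stability_operator gamma omega A J).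

(* The factors are polynomials in this quantity. *)
Definition spectral_var (gamma : R) : {poly R} :=
  if gamma == -1 then 'X else 'X^2.

Definition invariant d (F : 'M[R]_d) (W : {vspace 'cV[R]_d}) : Prop :=
  forall v, v \in W -> F *m v \in W.

(* Matrix, in a basis of W, of the restriction to W of F (for W F-invariant).  *)
Definition restriction d (F : 'M[R]_d) (W : {vspace 'cV[R]_d}) :
    'M[R]_(\dim W) :=
  \matrix_(i, j) coord (vbasis W) i (F *m (vbasis W)`_j).

Definition restricted_poly (gamma omega : R) d (A J : 'M[R]_d)
    (W : {vspace 'cV[R]_d}) : {poly R} :=
  stability_poly gamma omega (restriction A W) (restriction J W).

(* W is an invariant subspace of dimension e and the determinant of the        *)
(* restricted operator is q, of degree e, evaluated at the spectral variable.  *)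
Definition invariant_factor (gamma omega : R) d (A J : 'M[R]_d)
    (W : {vspace 'cV[R]_d}) (e : nat) (q : {poly R}) : Prop :=
  [/\ invariant A W, invariant J W, \dim W = e,
      restricted_poly gamma omega A J W = q \Po spectral_var gamma
    & size q = e.+1].

End Stability.

(* Main.v *)
(** Write G for the action on configurations of the rotation by 2 pi / n together
    with the permutation of the points that it induces, so that G ^ n = 1. The
    invariant subspaces are the eigenspaces U_k, k = 0, ..., n./2, of the operator
    G + G^-1, with eigenvalue 2 cos (2 pi k / n): V consists of U_0 and, for even n,
    of U_(n/2), Z is U_1, and W lists the others. The discrete cosine averages of
    the powers of G sum to the identity and take values in the U_k, so they give
    the projections onto the U_k, whose dimensions are traces: G ^ j fixes only
    the a points at the origin for 0 < j < n.

    A and J commute with G. The action F of the reflection commutes with A,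
    anticommutes with J and preserves every U_k; conjugating by F changes the sign
    of lambda, hence the factors are even in lambda in the N-body case.

    The force is translation invariant, rotation equivariant and homogeneous of
    degree 2 gamma + 1; differentiating these three symmetries at a relative
    equilibrium gives the action of A on translations, on J x and on x. *)

Require Import Defs.
From mathcomp Require Import all_boot all_order all_algebra fingroup.
From mathcomp Require Import mxrepresentation.
From mathcomp Require Import perm mxtens ring lra zify.
From mathcomp Require Import all_classical all_reals all_analysis.

Import Order.TTheory GRing.Theory Num.Theory.
Import numFieldNormedType.Exports.
Local Open Scope classical_set_scope.
Local Open Scope ring_scope.

Set Implicit Arguments.
Unset Strict Implicit.
Unset Printing Implicit Defensive.

Local Notation invariant := Defs.invariant.

(** * Restrictions and block-triangular determinants *)

Section Restriction.
Context {R : realType} {d : nat}.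
Implicit Types (U C W : {vspace 'cV[R]_d}) (v : 'cV[R]_d).

Definition basis_mx W : 'M[R]_(d, \dim W) := \matrix_(k, i) (vbasis W)`_i k 0.

Lemma col_basis_mx W i : col i (basis_mx W) = (vbasis W)`_i.
Proof. by apply/matrixP => k j; rewrite !mxE ord1. Qed.

Lemma mul_basis_mxE W (z : 'cV[R]_(\dim W)) :
  basis_mx W *m z = \sum_i z i 0 *: (vbasis W)`_i.
Proof.
apply/matrixP => k j; rewrite ord1 mxE summxE; apply: eq_bigr => i _.
by rewrite !mxE mulrC.
Qed.

Lemma memv_mul_basis_mx W (z : 'cV[R]_(\dim W)) : basis_mx W *m z \in W.
Proof.
rewrite mul_basis_mxE rpred_sum // => i _; rewrite rpredZ //.
by rewrite vbasis_mem // mem_nth // size_tuple.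
Qed.

Lemma basis_mx_coord W v : v \in W ->
  basis_mx W *m (\col_i coord (vbasis W) i v) = v.
Proof.
move=> Wv; rewrite mul_basis_mxE [RHS](coord_vbasis Wv).
by apply: eq_bigr => i _; rewrite mxE.
Qed.

Lemma basis_mx_inj W (z : 'cV[R]_(\dim W)) : basis_mx W *m z = 0 -> z = 0.
Proof.
rewrite mul_basis_mxE => z0; apply/matrixP => i j; rewrite ord1 mxE.
by have /freeP/(_ _ z0) := basis_free (vbasisP W).
Qed.

Lemma basis_mx_fact W r (M : 'M[R]_(d, r)) :
  (forall j, col j M \in W) ->
  M = basis_mx W *m (\matrix_(i, j) coord (vbasis W) i (col j M)).
Proof.
move=> WM; apply/matrixP => k j.
have := basis_mx_coord (WM j) => /matrixP/(_ k 0); rewrite [RHS]mxE => <-.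
by rewrite !mxE; apply: eq_bigr => i _; rewrite !mxE.
Qed.

Lemma restrictionE (F : 'M[R]_d) W : invariant F W ->
  F *m basis_mx W = basis_mx W *m restriction F W.
Proof.
move=> FW.
have FWc j : col j (F *m basis_mx W) = F *m (vbasis W)`_j.
  by rewrite colE -mulmxA -colE col_basis_mx.
rewrite {1}(basis_mx_fact (W := W) (M := F *m basis_mx W)); last first.
  by move=> j; rewrite FWc FW // vbasis_mem // mem_nth // size_tuple.
by congr (_ *m _); apply/matrixP => i j; rewrite !mxE FWc.
Qed.

(** Cancels [basis_mx W] on the left. Together with [restrictionE] it turns identities between
    restrictions into identities between the ambient matrices. *)
Lemma basis_mx_inj_mx W r (z : 'M[R]_(\dim W, r)) : basis_mx W *m z = 0 -> z = 0.
Proof.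
move=> z0; apply/matrixP => i j.
have /matrixP/(_ i 0) : col j z = 0.
  by apply: basis_mx_inj; rewrite colE mulmxA z0 mul0mx.
by rewrite !mxE.
Qed.

End Restriction.

(** * Stability determinants of invariant subspaces and their sums *)

Section StabilityPolynomial.
Context {R : realType}.
Variables gamma omega : R.

(** Both problems have an operator of the form [A + diag + gyro *: J] with scalar polynomials [diag]
    and [gyro], so the determinant arguments are made once for both. *)
Definition stability_diag : {poly R} :=
  if gamma == -1 then omega%:P else 'X^2 - (omega ^+ 2)%:P.
Definition stability_gyro : {poly R} :=
  if gamma == -1 then 'X else (2 * omega)%:P * 'X.

Lemma stability_operatorE d (A J : 'M[R]_d) :
  stability_operator gamma omega A J =
    map_mx polyC A + stability_diag%:M + stability_gyro *: map_mx polyC J.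
Proof. by rewrite /stability_operator /stability_diag /stability_gyro; case: ifP. Qed.

(** An injective square [X] is invertible; it intertwines the two operators, and its constant
    nonzero determinant cancels. The sizes are equal only propositionally because [X] will compare
    bases indexed by [\dim (U + C)] and by [\dim U + \dim C]. *)
Lemma stability_poly_similar p q (X : 'M[R]_(p, q)) (A J : 'M[R]_p)
    (A' J' : 'M[R]_q) :
  p = q -> (forall z : 'cV_q, X *m z = 0 -> z = 0) ->
  A *m X = X *m A' -> J *m X = X *m J' ->
  stability_poly gamma omega A J = stability_poly gamma omega A' J'.
Proof.
move=> pq; case: q / pq X A' J' => X A' J' Xinj AX JX.
have X0 : \det X != 0.
  rewrite -unitfE -unitmxE -unitmx_tr -row_free_unit -kermx_eq0.
  apply/eqP/trmx_inj/matrixP => i j; rewrite trmx0.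
  have /matrixP/(_ i 0) : col j (kermx X^T)^T = 0.
    apply: Xinj; rewrite colE mulmxA.
    by rewrite -[X in X *m _^T *m _]trmxK -trmx_mul mulmx_ker trmx0 mul0mx.
  by rewrite !mxE.
have: stability_operator gamma omega A J *m map_mx polyC X
    = map_mx polyC X *m stability_operator gamma omega A' J'.
  rewrite !stability_operatorE !mulmxDl !mulmxDr -!map_mxM AX scalar_mxC.
  by rewrite -scalemxAl -scalemxAr -!map_mxM JX.
move/(congr1 (fun M => \det M)); rewrite !det_mulmx det_map_mx mulrC => /mulfI; apply.
by rewrite polyC_eq0.
Qed.

Lemma stability_poly_block p q (A1 J1 : 'M[R]_p) (A2 J2 : 'M[R]_q)
    (A3 J3 : 'M[R]_(p, q)) :
  stability_poly gamma omega (block_mx A1 A3 0 A2) (block_mx J1 J3 0 J2) =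
  stability_poly gamma omega A1 J1 * stability_poly gamma omega A2 J2.
Proof.
rewrite /stability_poly !stability_operatorE !map_block_mx scalar_mx_block.
by rewrite scale_block_mx !add_block_mx !map_mx0 scaler0 !addr0 det_ublock.
Qed.

Section Subspaces.
Context {d : nat}.
Implicit Types (U C W : {vspace 'cV[R]_d}) (A J : 'M[R]_d).

Lemma invariant_addv F U W :
  invariant F U -> invariant F W -> invariant F (U + W)%VS.
Proof.
move=> FU FW v /memv_addP[u Uu [w Ww ->]].
by rewrite mulmxDr memv_add // ?FU ?FW.
Qed.

(** Here [C] is merely a complement and need not be invariant, whence the component [M1] along [U],
    which becomes an off-diagonal block. *)
Lemma invariant_addv_fact F U C : invariant F (U + C)%VS ->
  exists M1 M2, F *m basis_mx C = basis_mx U *m M1 + basis_mx C *m M2.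
Proof.
move=> FUC; pose M := F *m basis_mx C.
have MUC j : col j M \in (U + C)%VS.
  rewrite /M colE -mulmxA -colE col_basis_mx FUC // (subvP (addvSr U C)) //.
  by rewrite vbasis_mem // mem_nth // size_tuple.
pose M1 := \matrix_(k, j) (addv_pi1 U C (col j M)) k 0.
pose M2 := \matrix_(k, j) (addv_pi2 U C (col j M)) k 0.
have cM1 j : col j M1 = addv_pi1 U C (col j M).
  by apply/matrixP => k l; rewrite !mxE ord1.
have cM2 j : col j M2 = addv_pi2 U C (col j M).
  by apply/matrixP => k l; rewrite !mxE ord1.
have MD : M = M1 + M2.
  apply/matrixP => k j; rewrite !mxE.
  have := addv_pi1_pi2 (MUC j) => /matrixP/(_ k 0).
  by rewrite [RHS]mxE [LHS]mxE -/M => ->; rewrite /M mxE.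
rewrite -/M MD.
eexists; eexists; congr (_ + _); apply: basis_mx_fact => j.
  by rewrite cM1 memv_pi1.
by rewrite cM2 memv_pi2.
Qed.

(** In the basis made of a basis of [U] followed by one of [C], both [A] and [J] are block upper
    triangular, with lower right blocks [M2] and [K2]. *)
Lemma restricted_poly_block A J U C M1 M2 K1 K2 :
  (U :&: C = 0)%VS -> invariant A U -> invariant J U ->
  invariant A (U + C)%VS -> invariant J (U + C)%VS ->
  A *m basis_mx C = basis_mx U *m M1 + basis_mx C *m M2 ->
  J *m basis_mx C = basis_mx U *m K1 + basis_mx C *m K2 ->
  restricted_poly gamma omega A J (U + C)%VS =
    restricted_poly gamma omega A J U * stability_poly gamma omega M2 K2.
Proof.
move=> dUC AU JU AUC JUC AC JC.
pose X := row_mx (basis_mx U) (basis_mx C).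
have XUC j : col j X \in (U + C)%VS.
  rewrite -[j]splitK; case: (fintype.split j) => i.
    rewrite colKl col_basis_mx (subvP (addvSl U C)) //.
    by rewrite vbasis_mem // mem_nth // size_tuple.
  rewrite colKr col_basis_mx (subvP (addvSr U C)) //.
  by rewrite vbasis_mem // mem_nth // size_tuple.
(* [Y] is the change of basis from the joined basis to the chosen basis of the sum. *)
have [Y XY] : exists Y, X = basis_mx (U + C)%VS *m Y.
  by eexists; apply: basis_mx_fact.
rewrite /restricted_poly -(stability_poly_block _ _ _ _ M1 K1).
have key F (N1 : 'M[R]_(\dim U, \dim C)) N2 : invariant F U -> invariant F (U + C)%VS ->
   F *m basis_mx C = basis_mx U *m N1 + basis_mx C *m N2 ->
   restriction F (U + C) *m Y = Y *m block_mx (restriction F U) N1 0 N2.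
  move=> FU FUC FC; apply/eqP; rewrite -subr_eq0; apply/eqP.
  apply: basis_mx_inj_mx; rewrite mulmxBr !mulmxA -restrictionE // -XY -mulmxA -XY.
  rewrite /X mul_mx_row mul_row_block !mulmx0 !addr0 restrictionE // FC.
  by rewrite subrr.
apply: (@stability_poly_similar _ _ Y).
- exact: dimv_disjoint_sum.
- move=> z Yz; have : X *m z = 0 by rewrite XY -mulmxA Yz mulmx0.
  rewrite -[z]vsubmxK /X mul_row_col => /eqP; rewrite addr_eq0 => /eqP zz.
  have z1 : basis_mx U *m usubmx z = 0.
    apply/eqP; rewrite -memv0 -dUC memv_cap memv_mul_basis_mx /=.
    by rewrite zz rpredN memv_mul_basis_mx.
  move/eqP: zz; rewrite z1 eq_sym oppr_eq0 => /eqP z2.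
  by rewrite (basis_mx_inj z1) (basis_mx_inj z2) col_mx0.
- exact: key.
- exact: key.
Qed.

Lemma restricted_poly_addv A J U C :
  (U :&: C = 0)%VS -> invariant A U -> invariant J U ->
  invariant A C -> invariant J C ->
  restricted_poly gamma omega A J (U + C)%VS =
    restricted_poly gamma omega A J U * restricted_poly gamma omega A J C.
Proof.
move=> dUC AU JU AC JC.
apply: (@restricted_poly_block A J U C 0 _ 0) => //; try exact: invariant_addv.
  by rewrite mulmx0 add0r restrictionE.
by rewrite mulmx0 add0r restrictionE.
Qed.

(** The cofactor is the stability polynomial of the lower right blocks for an arbitrary complement
    of [U] in [W], i.e. of the maps induced on the quotient. *)
Lemma restricted_poly_dvdp A J U W :
  (U <= W)%VS -> invariant A U -> invariant J U ->
  invariant A W -> invariant J W ->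
  restricted_poly gamma omega A J U %| restricted_poly gamma omega A J W.
Proof.
move=> UW AU JU AW JW.
pose C := (W :\: U)%VS.
have WE : W = (U + C)%VS by rewrite addvC -{1}(addv_diff_cap W U) (capv_idPr UW).
have dUC : (U :&: C = 0)%VS by rewrite capvC capv_diff.
move: AW JW; rewrite WE => AW JW.
have [M1 [M2 MC]] := invariant_addv_fact AW.
have [K1 [K2 KC]] := invariant_addv_fact JW.
by rewrite (restricted_poly_block _ AU JU _ _ MC KC) // dvdp_mulr.
Qed.

Lemma restricted_poly_fullv A J :
  restricted_poly gamma omega A J fullv = stability_poly gamma omega A J.
Proof.
symmetry; apply: (@stability_poly_similar _ _ (basis_mx fullv)).
- by rewrite dimvf /dim /= muln1.
- by move=> z; apply: basis_mx_inj.
- by rewrite restrictionE // => v _; apply: memvf.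
- by rewrite restrictionE // => v _; apply: memvf.
Qed.

Lemma invariant_sumv F I (r : seq I) (U : I -> {vspace 'cV[R]_d}) :
  (forall i, invariant F (U i)) -> invariant F (\sum_(i <- r) U i)%VS.
Proof.
move=> FU; elim/big_ind: _ => [v||i _ //]; last exact: invariant_addv.
by rewrite memv0 => /eqP ->; rewrite mulmx0 mem0v.
Qed.

Lemma restricted_poly0 A J : restricted_poly gamma omega A J 0%VS = 1.
Proof.
rewrite /restricted_poly /stability_poly.
by move: (stability_operator _ _ _ _); rewrite dimv0 => M; rewrite det_mx00.
Qed.

(** The dimension of a sum is at most the sum of the dimensions, so equality for [h.+1] summands
    forces equality for the first [h] and makes the last summand meet their sum trivially. *)
Lemma restricted_poly_sumv A J h (U : nat -> {vspace 'cV[R]_d}) :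
  (forall k, invariant A (U k)) -> (forall k, invariant J (U k)) ->
  \dim (\sum_(k < h) U k) = (\sum_(k < h) \dim (U k))%N ->
  restricted_poly gamma omega A J (\sum_(k < h) U k)%VS =
    \prod_(k < h) restricted_poly gamma omega A J (U k).
Proof.
move=> AU JU; elim: h => [|h IH] dU.
  by rewrite !big_ord0 restricted_poly0.
have h1 := dimv_add_leqif (\sum_(k < h) U k)%VS (U h).
have h2 : (\dim (\sum_(k < h) U k) <= \sum_(k < h) \dim (U k))%N.
  elim/big_ind2: _ => [|p X q Y pX qY|//]; rewrite ?dimv0 //.
  exact: leq_trans (dimv_add_leqif _ _).1 (leq_add _ _).
have := h1.1; rewrite !big_ord_recr /= in dU *; rewrite dU leq_add2r => h3.
have h4 : \dim (\sum_(k < h) U k) = (\sum_(k < h) \dim (U k))%N.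
  by apply/eqP; rewrite eqn_leq h2 h3.
have dUa : ((\sum_(k < h) U k) :&: U h = 0)%VS.
  by apply/eqP; rewrite -subv0 -h1.2 dU h4.
by rewrite (restricted_poly_addv dUa) ?IH //; exact: invariant_sumv.
Qed.

End Subspaces.
End StabilityPolynomial.

(** * Degrees of determinants and polynomials in the square of the variable *)

Section DegreeParity.
Context {R : realType}.

(** The identity permutation contributes a term of degree [k * e]. Any other permutation picks an
    off-diagonal entry, of degree below [k], so its term has strictly smaller degree. *)
Lemma size_det_monic_perturb k e (N : 'M[{poly R}]_e) : (0 < k)%N ->
  (forall i j, (size (N i j) <= k)%N) ->
  size (\det (('X^k)%:M + N)) = (k * e).+1.
Proof.
move=> k0 Nk; pose M := ('X^k)%:M + N.
have sd i : size (M i i) = k.+1.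
  rewrite /M !mxE eqxx mulr1n size_polyDl size_polyXn // ltnS; exact: Nk.
have so i j : i != j -> (size (M i j) <= k)%N.
  by move=> /negbTE ij; rewrite /M !mxE ij mulr0n add0r.
have sM i j : (size (M i j) <= k.+1)%N.
  by case: (eqVneq i j) => [->|ij]; [rewrite sd | exact/leqW/so].
rewrite -/M /determinant (bigD1 (1%g : 'S_e)) //= odd_perm1 expr0 mul1r.
rewrite size_polyDl.
  rewrite size_prod => [|i _]; last by rewrite perm1 -size_poly_gt0 sd.
  rewrite (eq_bigr (fun=> k.+1)) => [|i _]; last by rewrite perm1 sd.
  rewrite sum_nat_const !cardT size_enum_ord; lia.
have -> : size (\prod_(i < e) M i ((1 : 'S_e)%g i)) = (k * e).+1.
  rewrite size_prod => [|i _]; last by rewrite perm1 -size_poly_gt0 sd.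
  rewrite (eq_bigr (fun=> k.+1)) => [|i _]; last by rewrite perm1 sd.
  rewrite sum_nat_const !cardT size_enum_ord; lia.
rewrite ltnS; apply: (leq_trans (size_sum _ _ _)); apply/bigmax_leqP => s s1.
rewrite -signr_odd; apply: (@leq_trans (size (\prod_(i < e) M i (s i)))).
  by case: (odd _); rewrite ?expr0 ?mul1r // expr1 mulN1r size_polyN.
have [i si] : exists i, s i != i.
  apply/existsP; rewrite -negb_forall; apply: contra s1 => /forallP h.
  by apply/eqP/permP => i; rewrite perm1; exact/eqP.
apply: (leq_trans (size_prod_leq _ _)).
rewrite (bigD1 i) //=.
have si' : (size (M i (s i)) <= k)%N by rewrite so // eq_sym.
have : (\sum_(i0 < e | i0 != i) size (M i0 (s i0)) <= \sum_(i0 < e | i0 != i) k.+1)%N.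
  by apply: leq_sum.
rewrite sum_nat_const cardC1 !cardT size_enum_ord.
have e0 : (0 < e)%N := leq_ltn_trans (leq0n i) (ltn_ord i).
have : (k * e = k * e.-1 + k)%N by rewrite -{1}(prednK e0) mulnS addnC.
rewrite mulnS [(e.-1 * k)%N]mulnC => ->.
move: (size _) (\sum_(i0 < e | _) _)%N si' => u t uk tk; lia.
Qed.

(** Substituting [- 'X] changes the sign of the odd part, so twice that part is zero. *)
Lemma even_polyP (p : {poly R}) : p \Po - 'X = p -> p = even_poly p \Po 'X^2.
Proof.
move=> pE; have := poly_even_odd p; set o := odd_poly p \Po _ => pD.
have X2 (q : {poly R}) : (q \Po 'X^2) \Po - 'X = q \Po 'X^2.
  by rewrite -comp_polyA comp_Xn_poly sqrrN.
have := pE; rewrite -{1}pD comp_polyD comp_polyM !X2 comp_polyX mulrN -[RHS]pD.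
move/addrI/eqP; rewrite eq_sym -addr_eq0 -mulr2n -mulr_natl mulf_eq0.
rewrite -polyC_natr polyC_eq0 pnatr_eq0 /= => /eqP o0.
by rewrite -[LHS]pD o0 addr0.
Qed.

Lemma size_comp_X2 (q : {poly R}) e : size (q \Po 'X^2) = (2 * e).+1 -> size q = e.+1.
Proof.
move=> s; have := size_comp_poly q 'X^2; rewrite s size_polyXn /=.
have : q != 0 by apply: contra_eq_neq s => ->; rewrite comp_poly0 size_poly0.
rewrite -size_poly_gt0; move: (size q) => t; lia.
Qed.

(** Substitute ['X^2] in the Euclidean division of [q] by [p]: the remainder stays of smaller degree
    than the divisor, yet is divisible by it, so it is zero. *)
Lemma dvdp_comp_X2 (p q : {poly R}) : p != 0 -> p \Po 'X^2 %| q \Po 'X^2 -> p %| q.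
Proof.
move=> p0; rewrite {1}(divp_eq q p) comp_polyD comp_polyM dvdp_addr ?dvdp_mull //.
rewrite /dvdp -/(dvdp _ _) => pr; apply/eqP; apply: contraTeq pr => r0.
have rs := ltn_modpN0 q p0; apply/negP => /dvdp_leq.
have := size_comp_poly (q %% p) 'X^2; have := size_comp_poly p 'X^2.
have : q %% p \Po 'X^2 != 0.
  apply: contra r0 => /eqP h; have := size_comp_poly (q %% p) 'X^2.
  rewrite h size_poly0 size_polyXn /= => h2.
  have : (size (q %% p)%R <= 1)%N by move: h2; move: (size _) => t; lia.
  move=> /size1_polyC h3; rewrite h3 comp_polyC in h; rewrite h3 h //.
rewrite -!size_poly_gt0 size_polyXn /= in r0 p0 rs * => h1 h2 h3 h4.
have := h4 h1; move: r0 p0 rs h1 h2 h3 {h4}.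
by move: (size _) (size _) (size _) (size _) => t u v w; lia.
Qed.

End DegreeParity.

(** * Factors attached to invariant subspaces *)

Section InvariantFactor.
Context {R : realType} {d : nat}.
Variables gamma omega : R.
Implicit Types (U W : {vspace 'cV[R]_d}) (A J G : 'M[R]_d).

Lemma restrictionM U A G : invariant A U -> invariant G U ->
  restriction (A *m G) U = restriction A U *m restriction G U.
Proof.
move=> AU GU; apply/eqP; rewrite -subr_eq0; apply/eqP; apply: basis_mx_inj_mx.
rewrite mulmxBr -restrictionE; last by move=> v Uv; rewrite -mulmxA AU // GU.
by rewrite mulmxA -restrictionE // -!mulmxA restrictionE // subrr.
Qed.

Lemma restrictionN U A : restriction (- A) U = - restriction A U.
Proof. by apply/matrixP => i j; rewrite !mxE mulNmx linearN. Qed.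

Lemma restriction1 U : restriction 1%:M U = 1%:M.
Proof.
apply/eqP; rewrite -subr_eq0; apply/eqP; apply: basis_mx_inj_mx.
by rewrite mulmxBr -restrictionE ?mul1mx ?mulmx1 ?subrr // => v; rewrite mul1mx.
Qed.

(* Conjugation by G, which commutes with A and anticommutes with J, changes the sign of 'X. *)
Lemma stability_poly_even e (A J G : 'M[R]_e) :
  gamma != -1 -> G *m G = 1%:M -> A *m G = G *m A -> J *m G = - (G *m J) ->
  stability_poly gamma omega A J \Po - 'X = stability_poly gamma omega A J.
Proof.
move=> g1 GG AG JG.
rewrite /stability_poly; set B := stability_operator _ _ _ _.
pose M := map_mx (comp_poly (- 'X)) B.
have -> : \det B \Po - 'X = \det M by rewrite [RHS]det_map_mx.
have : M *m map_mx polyC G = map_mx polyC G *m B.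
  have -> : M = map_mx polyC A + ('X^2 - (omega ^+ 2)%:P)%:M
             - ((2 * omega)%:P * 'X) *: map_mx polyC J.
    rewrite /M /B /stability_operator (negbTE g1); apply/matrixP => i j; rewrite !mxE.
    rewrite !comp_polyD !comp_polyM !comp_polyC comp_polyX.
    rewrite mulrN mulNr; congr (_ + _ - _).
    by case: eqP => _; rewrite ?mulr0n ?comp_poly0 // mulr1n comp_polyB comp_Xn_poly sqrrN comp_polyC.
  rewrite /B /stability_operator (negbTE g1) !mulmxDl !mulmxDr -!map_mxM AG scalar_mxC.
  by rewrite mulNmx -scalemxAl -scalemxAr -!map_mxM JG map_mxN scalerN opprK.
move/(congr1 (fun M => \det M)); rewrite !det_mulmx det_map_mx mulrC => /mulfI; apply.
have /(congr1 (fun M => \det M)) := GG; rewrite det_map_mx polyC_eq0.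
by rewrite det_mulmx det1; apply: contra_eq_neq => ->; rewrite mul0r eq_sym oner_neq0.
Qed.

(** The term ['X^2] sits on the diagonal with coefficient one, and the gyroscopic term has degree at
    most one. *)
Lemma size_stability_poly_body e (A J : 'M[R]_e) : gamma != -1 ->
  size (stability_poly gamma omega A J) = (2 * e).+1.
Proof.
move=> g1; rewrite /stability_poly /stability_operator (negbTE g1).
set D := ('X^2 - _)%:M; set K := _ *: _.
have -> : map_mx polyC A + D + K = ('X^2)%:M + (map_mx polyC (A - (omega ^+ 2)%:M) + K).
  rewrite /D rmorphB map_mxB map_scalar_mx /= !addrA.
  by rewrite [map_mx _ A + _]addrC.
rewrite size_det_monic_perturb // => i j; rewrite !mxE.
rewrite (leq_trans (size_polyD _ _)) // geq_max; apply/andP; split.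
  by rewrite (leq_trans (size_polyC_leq1 _)).
rewrite mulrAC -polyCM (leq_trans (size_polyMleq _ _)) // size_polyX.
have := size_polyC_leq1 (2 * omega * J i j).
by move: (size _) => t; lia.
Qed.

(** Here ['X] multiplies [J]. Multiplying the operator by [- J], the inverse of [J], makes it monic
    in ['X] and changes the determinant only by a nonzero constant. *)
Lemma size_stability_poly_vortex e (A J : 'M[R]_e) : gamma = -1 ->
  J *m J = - 1%:M -> size (stability_poly gamma omega A J) = e.+1.
Proof.
move=> g1 JJ; rewrite /stability_poly /stability_operator g1 eqxx.
have dJ : \det J != 0.
  have /(congr1 (fun M => \det M)) := JJ.
  rewrite det_mulmx -scaleN1r detZ det1 mulr1; apply: contra_eq_neq => ->.
  by rewrite mul0r eq_sym signr_eq0.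
set B := _ + _ + _.
have : map_mx polyC (- J) *m B = ('X^1)%:M + map_mx polyC (- J *m (A + omega%:M)).
  rewrite /B mulmxDr addrC -scalemxAr -map_mxM mulNmx JJ opprK map_mx1 scalemx1.
  by rewrite expr1 map_mxM map_mxD map_scalar_mx.
move/(congr1 (fun M : 'M[{poly R}]_e => size (\det M))); rewrite size_det_monic_perturb // => [|i j]; last first.
  by rewrite mxE size_polyC_leq1.
by rewrite mul1n det_mulmx det_map_mx size_Cmul // -scaleN1r detZ mulf_neq0 // signr_eq0.
Qed.

(** [G] will be the reflection. Its restriction to [U] makes the restricted determinant even in the
    N-body case, where [q] is its even part; in the N-vortex case [q] is the restricted determinant
    itself. *)
Lemma invariant_factor_exists A J G U :
  invariant A U -> invariant J U -> invariant G U ->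
  J *m J = - 1%:M -> G *m G = 1%:M -> A *m G = G *m A -> J *m G = - (G *m J) ->
  exists q, invariant_factor gamma omega A J U (\dim U) q.
Proof.
move=> AU JU GU JJ GG AG JG.
have rJJ : restriction J U *m restriction J U = - 1%:M.
  by rewrite -restrictionM // JJ restrictionN restriction1.
have [g1|g1] := eqVneq gamma (-1).
  exists (restricted_poly gamma omega A J U); split => //.
    by rewrite /spectral_var g1 eqxx comp_polyXr.
  by rewrite size_stability_poly_vortex.
have even : restricted_poly gamma omega A J U \Po - 'X = restricted_poly gamma omega A J U.
  apply: (@stability_poly_even _ _ _ (restriction G U)) => //.
  - by rewrite -restrictionM // GG restriction1.
  - by rewrite -!restrictionM // AG.
  - by rewrite -!restrictionM // JG restrictionN.
exists (even_poly (restricted_poly gamma omega A J U)); split => //.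
  by rewrite /spectral_var (negbTE g1) -even_polyP.
apply: size_comp_X2; rewrite -even_polyP //.
exact: size_stability_poly_body.
Qed.

Lemma invariant_factor_dvdp A J U W e f p q :
  invariant_factor gamma omega A J U e p ->
  invariant_factor gamma omega A J W f q ->
  (U <= W)%VS -> p %| q.
Proof.
move=> [AU JU _ pE ps] [AW JW _ qE _] UW.
have p0 : p != 0 by rewrite -size_poly_gt0 ps.
have := restricted_poly_dvdp gamma omega UW AU JU AW JW; rewrite pE qE.
rewrite /spectral_var; case: eqP => _; rewrite ?comp_polyXr //; exact: dvdp_comp_X2.
Qed.

End InvariantFactor.

(** * Isotypic decomposition of a cyclic action *)

Section CyclicTrig.
Context {R : realType}.
Implicit Types (t : R).

Lemma sum_ord_shift (V : nmodType) n (F : nat -> V) : F n = F 0%N ->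
  \sum_(j < n) F j.+1 = \sum_(j < n) F j.
Proof.
case: n => [|n] Fn; first by rewrite !big_ord0.
by rewrite big_ord_recr /= Fn [RHS]big_ord_recl /= addrC.
Qed.

Lemma cos_nat_period t k : cos (t + k%:R * (2 * pi)) = cos t.
Proof.
by rewrite !mulr_natl (periodicn (@cosD2pi R)). Qed.

(** This three-term recurrence is what makes cosine averages of the powers of [G] eigenvectors of
    [G + G^-1]. *)
Lemma cos_prevD_next (j : nat) t :
  cos ((j%:R - 1) * t) + cos (j.+1%:R * t) = 2 * cos t * cos (j%:R * t).
Proof.
have -> : (j%:R - 1) * t = j%:R * t - t by ring.
have -> : j.+1%:R * t = j%:R * t + t by rewrite -[j.+1%:R]natr1; ring.
by rewrite cosB cosD; ring.
Qed.

Definition angle n : R := 2 * pi / n%:R.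

Lemma natr_angle n : (0 < n)%N -> n%:R * angle n = 2 * pi.
Proof. by move=> n0; rewrite /angle mulrC divfK // pnatr_eq0 -lt0n. Qed.

Lemma cos_angle_neq1 n j : (0 < j < n)%N -> cos (j%:R * angle n) != 1.
Proof.
move=> /andP[j0 jn]; have n0' : (0 < n)%N by rewrite (leq_ltn_trans _ jn).
have n0 : (0 : R) < n%:R by rewrite ltr0n.
have -> : j%:R * angle n = (pi * (j%:R / n%:R)) *+ 2.
  by rewrite /angle -mulr_natl; field; rewrite gt_eqF.
rewrite cos_mulr2n -subr_eq0 cos2sin2.
have : 0 < sin (pi * (j%:R / n%:R) : R).
  apply: sin_gt0_pi.
  rewrite mulr_gt0 ?pi_gt0 ?divr_gt0 ?ltr0n //=.
  by rewrite gtr_pMr ?pi_gt0 // ltr_pdivrMr // mul1r ltr_nat.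
set s := sin _ => s0; rewrite -mulr_natl.
have : 0 < s ^+ 2 by rewrite exprn_gt0.
by move=> ?; apply/eqP; lra.
Qed.

(** Shifting the index by one either way leaves the sum [C] unchanged. Adding the two shifted sums
    gives [2 * C = 2 * cos b * C] by the recurrence, and [cos b] is not 1. *)
Lemma sum_cos_angle n j : (0 < j < n)%N ->
  \sum_(k < n) cos (k%:R * (j%:R * angle n)) = 0 :> R.
Proof.
move=> jn; have n0 : (0 < n)%N by case/andP: jn => _; apply: leq_trans.
set b := j%:R * angle n; set C := \sum_(k < n) _.
have nb : n%:R * b = 0 + j%:R * (2 * pi) by rewrite /b mulrCA natr_angle // add0r.
have C1 : \sum_(k < n) cos (k.+1%:R * b) = C.
  apply: (@sum_ord_shift _ _ (fun k => cos (k%:R * b))).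
  by rewrite nb cos_nat_period mul0r.
have C2 : \sum_(k < n) cos ((k%:R - 1) * b) = C.
  rewrite -(@sum_ord_shift _ _ (fun k => cos ((k%:R - 1) * b))).
    by apply: eq_bigr => k _; congr (cos (_ * _)); rewrite -[_.+1%:R]natr1 addrK.
  by rewrite mulrBl nb add0r addrC cos_nat_period mulrBl mul0r add0r.
have : C + C = 2 * cos b * C.
  rewrite -{1}C1 -{1}C2 -big_split mulr_sumr /=; apply: eq_bigr => k _.
  by rewrite addrC cos_prevD_next.
have := cos_angle_neq1 jn; rewrite -/b => b1 CC.
have : (1 - cos b) * C = 0 by lra.
by move/eqP; rewrite mulf_eq0 subr_eq0 eq_sym (negbTE b1) => /eqP.
Qed.

Lemma sum_cos_angle_eq n j : (j < n)%N ->
  \sum_(k < n) cos (k%:R * (j%:R * angle n)) = n%:R *+ (j == 0)%N :> R.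
Proof.
case: j => [|j] jn; last by rewrite sum_cos_angle.
rewrite eqxx mulr1n (eq_bigr (fun=> 1)) ?sumr_const ?card_ord // => k _.
by rewrite mul0r mulr0 cos0.
Qed.

(** For indices up to [n./2] the angles lie in [0, pi], where the cosine is injective. Hence the
    eigenvalues of [G + G^-1] with these indices are distinct. *)
Lemma cos_angle_inj n i j : (0 < n)%N -> (i <= n./2)%N -> (j <= n./2)%N ->
  cos (i%:R * angle n) = cos (j%:R * angle n) -> i = j.
Proof.
move=> n0; have n0R : (0 : R) < n%:R by rewrite ltr0n.
have bnd k : (k <= n./2)%N -> k%:R * angle n \in `[0, pi].
  move=> kn; rewrite in_itv /=; apply/andP; split.
    by rewrite mulr_ge0 // /angle divr_ge0 ?mulr_ge0 ?pi_ge0.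
  rewrite /angle mulrA ler_pdivrMr // mulrA [_ * n%:R]mulrC.
  rewrite ler_pM2r ?pi_gt0 // -natrM ler_nat; lia.
move=> /bnd hi /bnd hj /(cos_inj hi hj) /mulIf ij.
apply/eqP; rewrite -(eqr_nat R) ij // /angle.
by rewrite mulf_neq0 ?invr_eq0 ?gt_eqF ?mulr_gt0 ?pi_gt0.
Qed.

End CyclicTrig.

Section CyclicAction.
Context {R : realType} {d : nat}.
Variables (n : nat) (G : 'M[R]_d).
Hypotheses (n2 : (2 < n)%N) (Gn : G ^+ n = 1).

Let n0 : (0 < n)%N. Proof. exact: ltn_trans n2. Qed.
Let nR0 : n%:R != 0 :> R. Proof. by rewrite pnatr_eq0 -lt0n. Qed.
Local Notation alpha := (angle n : R).

(** [G ^+ n.-1] is the inverse of [G]. Adding it keeps the eigenvalues real and makes the operator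
    commute with the reflection, which conjugates [G] to its inverse. *)
Definition cyc_sum : 'M[R]_d := G + G ^+ n.-1.
Definition cyc_eig k : R := 2 * cos (k%:R * alpha).

(** Half the sum of the complex Fourier projections of [G] with indices [k] and [n - k]. *)
Definition cyc_avg k : 'M[R]_d :=
  n%:R^-1 *: \sum_(j < n) cos (j%:R * (k%:R * alpha)) *: G ^+ j.

(** Multiplication by [G] or its inverse shifts the powers cyclically. Moving the shift onto the
    cosine weights, which are periodic too, leaves the recurrence of the cosine. *)
Lemma cyc_sum_avg k : cyc_sum *m cyc_avg k = cyc_eig k *: cyc_avg k.
Proof.
rewrite /cyc_avg -scalemxAr [RHS]scalerA [cyc_eig k * _]mulrC -scalerA; congr (_ *: _).
set b := k%:R * alpha.
have nb : n%:R * b = 0 + k%:R * (2 * pi) by rewrite /b mulrCA natr_angle // add0r.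
have GG j : G ^+ n.-1 *m G ^+ j.+1 = G ^+ j.
  by rewrite -[_ *m _]exprD -addSnnS prednK // exprD Gn mul1r.
have C1 : \sum_(j < n) cos (j%:R * b) *: (G ^+ n.-1 *m G ^+ j) =
    \sum_(j < n) cos (j.+1%:R * b) *: G ^+ j.
  rewrite -(@sum_ord_shift _ _ (fun j => cos (j%:R * b) *: (G ^+ n.-1 *m G ^+ j))).
    by apply: eq_bigr => j _; rewrite GG.
  by rewrite Gn expr0 nb cos_nat_period mul0r.
have C2 : \sum_(j < n) cos (j%:R * b) *: (G *m G ^+ j) =
    \sum_(j < n) cos ((j%:R - 1) * b) *: G ^+ j.
  rewrite -(@sum_ord_shift _ _ (fun j => cos ((j%:R - 1) * b) *: G ^+ j)).
    by apply: eq_bigr => j _; rewrite -[_.+1%:R]natr1 addrK exprS.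
  by rewrite Gn expr0 mulrBl nb addrAC cos_nat_period mulrBl mul0r.
rewrite mulmx_sumr scaler_sumr /cyc_sum.
under eq_bigr => j _ do rewrite -scalemxAr mulmxDl scalerDr.
rewrite big_split /= C1 C2 -big_split /=; apply: eq_bigr => j _.
rewrite -scalerDl scalerA; congr (_ *: _).
by rewrite cos_prevD_next.
Qed.

(** After exchanging the sums, the cosines add up to zero over [k] for every power of [G] except the
    power zero. *)
Lemma sum_cyc_avg : \sum_(k < n) cyc_avg k = 1%:M.
Proof.
rewrite -scaler_sumr exchange_big /= (bigD1 (Ordinal n0)) //= [X in _ + X]big1 => [|j j0].
  rewrite addr0 -scaler_suml expr0 (eq_bigr (fun=> 1)) => [|k _].
    by rewrite sumr_const card_ord scalerA mulVf // scale1r.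
  by rewrite mul0r cos0.
rewrite -scaler_suml (eq_bigr (fun k : 'I_n => cos (k%:R * (j%:R * alpha)))).
  by rewrite sum_cos_angle ?scale0r // ltn_ord lt0n andbT.
by move=> k _; rewrite mulrCA.
Qed.

(* k and n - k give the same eigenvalue. *)
Definition cyc_fold (k : nat) := minn k (n - k).

Lemma cyc_eig_fold (k : nat) : (k < n)%N -> cyc_eig (cyc_fold k) = cyc_eig k.
Proof.
move=> kn; rewrite /cyc_eig /cyc_fold /minn; case: ifP => // _.
rewrite natrB ?(ltnW kn) // mulrBl natr_angle // addrC -[2 * pi]mul1r.
by rewrite (cos_nat_period _ 1) cosN.
Qed.

(** For [0 < l < n / 2] the averages of index [l] and [n - l] are equal, and each is only half of
    the projection. *)
Definition cyc_proj l : 'M[R]_d := \sum_(k < n | cyc_fold k == l) cyc_avg k.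

Lemma cyc_sum_proj l : cyc_sum *m cyc_proj l = cyc_eig l *: cyc_proj l.
Proof.
rewrite mulmx_sumr scaler_sumr; apply: eq_bigr => k /eqP <-.
by rewrite cyc_sum_avg cyc_eig_fold.
Qed.

Lemma cyc_fold_lt k : (cyc_fold k < n./2.+1)%N.
Proof. rewrite /cyc_fold; lia. Qed.

Lemma sum_cyc_proj : \sum_(l < n./2.+1) cyc_proj l = 1%:M.
Proof.
rewrite -sum_cyc_avg.
rewrite (partition_big (fun k : 'I_n => Ordinal (cyc_fold_lt k)) predT) //=.
Qed.

Lemma cyc_proj_comm l (F : 'M[R]_d) : F *m G = G *m F ->
  F *m cyc_proj l = cyc_proj l *m F.
Proof.
move=> FG; rewrite mulmx_sumr mulmx_suml; apply: eq_bigr => k _.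
rewrite -scalemxAr -scalemxAl mulmx_sumr mulmx_suml; congr (_ *: _).
apply: eq_bigr => j _; rewrite -scalemxAr -scalemxAl; congr (_ *: _).
exact: (commrX j FG).
Qed.

Lemma cyc_sum_comm (F : 'M[R]_d) : F *m G = G *m F ->
  F *m cyc_sum = cyc_sum *m F.
Proof.
move=> FG; rewrite /cyc_sum mulmxDr mulmxDl FG; congr (_ + _).
exact: (commrX n.-1 FG).
Qed.

Definition cyc_space l : {vspace 'cV[R]_d} :=
  lker (linfun (mulmx (cyc_sum - (cyc_eig l)%:M))).

Lemma mem_cyc_space l v : (v \in cyc_space l) = (cyc_sum *m v == cyc_eig l *: v).
Proof. by rewrite memv_ker lfunE /= mulmxBl mul_scalar_mx subr_eq0. Qed.

Lemma cyc_proj_mem l v : cyc_proj l *m v \in cyc_space l.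
Proof. by rewrite mem_cyc_space mulmxA cyc_sum_proj scalemxAl. Qed.

(** The components [cyc_proj k *m v] add up to [v]. Each is an eigenvector of [cyc_sum] for the
    eigenvalues of index [k] and [l] at once, hence zero unless [k = l]. *)
Lemma cyc_proj_id l v : (l < n./2.+1)%N -> v \in cyc_space l -> cyc_proj l *m v = v.
Proof.
move=> ln; rewrite mem_cyc_space => /eqP Sv.
have := congr1 (fun M => M *m v) sum_cyc_proj.
rewrite /= mulmx_suml mul1mx (bigD1 (Ordinal ln)) //= big1 ?addr0 // => k kl.
have : cyc_eig k *: (cyc_proj k *m v) = cyc_eig l *: (cyc_proj k *m v).
  rewrite scalemxAl -cyc_sum_proj cyc_proj_comm; first last.
    by rewrite /cyc_sum mulmxDl mulmxDr; congr (_ + _); apply/esym/(commrX n.-1).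
  by rewrite -mulmxA Sv -scalemxAr.
move/eqP; rewrite -subr_eq0 -scalerBl scaler_eq0 subr_eq0 => /orP[|/eqP//].
have two : (2 : R) != 0 by rewrite pnatr_eq0.
rewrite /cyc_eig => /eqP/(mulfI two) h; case/negP: kl; apply/eqP/val_inj => /=.
by apply: (@cos_angle_inj R n) => //; rewrite -ltnS ltn_ord.
Qed.

Lemma sum_cyc_space : (\sum_(l < n./2.+1) cyc_space l)%VS = fullv.
Proof.
apply/eqP; rewrite eqEsubv subvf /=.
apply/subvP => v _; rewrite -[v]mul1mx -sum_cyc_proj mulmx_suml.
by apply: memv_sumr => l _; exact: cyc_proj_mem.
Qed.

Lemma cyc_space_stable F l : F *m G = G *m F -> invariant F (cyc_space l).
Proof.
move=> FG v; rewrite !mem_cyc_space => /eqP Sv.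
by rewrite mulmxA -cyc_sum_comm // -mulmxA Sv -scalemxAr.
Qed.

(* Since F = F^-1, the last hypothesis says that F conjugates G to G^-1. *)
Lemma cyc_space_stable_inv F l : F *m F = 1%:M -> F *m G *m F *m G = 1%:M ->
  invariant F (cyc_space l).
Proof.
move=> FF FG v; rewrite !mem_cyc_space => /eqP Sv.
have Ginv : G *m G ^+ n.-1 = 1%:M by rewrite -[_ *m _]exprS prednK.
have Ginv' : G ^+ n.-1 *m G = 1%:M by rewrite -[_ *m _]exprSr prednK.
have FGF : F *m G *m F = G ^+ n.-1 by rewrite -[LHS]mulmx1 -Ginv mulmxA FG mul1mx.
have GF : G *m F = F *m G ^+ n.-1 by rewrite -FGF !mulmxA FF mul1mx.
have GF' : G ^+ n.-1 *m F = F *m G by rewrite -FGF -!mulmxA FF mulmx1.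
have SF : cyc_sum *m F = F *m cyc_sum.
  by rewrite /cyc_sum mulmxDl mulmxDr GF GF' addrC.
by rewrite mulmxA SF -mulmxA Sv -scalemxAr.
Qed.

End CyclicAction.

(** Write [P = B *m C] with [B] a basis matrix of [W]. As [P] fixes [W], [C *m B = 1], and [P] has
    the same trace as [C *m B]. *)
Lemma dim_proj_trace (R : realType) d (P : 'M[R]_d) (W : {vspace 'cV[R]_d}) :
  (forall v, P *m v \in W) -> (forall v, v \in W -> P *m v = v) ->
  (\dim W)%:R = \tr P.
Proof.
move=> PW Pid.
have PWc j : col j P \in W by rewrite colE PW.
have := basis_mx_fact PWc; set C := \matrix_(_, _) _ => PC.
rewrite PC mxtrace_mulC.
suff -> : C *m basis_mx W = 1%:M by rewrite mxtrace1.
apply/eqP; rewrite -subr_eq0; apply/eqP/basis_mx_inj_mx.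
rewrite mulmxBr mulmx1 mulmxA -PC; apply/eqP; rewrite subr_eq0; apply/eqP.
apply/matrixP => i j; have : col j (P *m basis_mx W) = col j (basis_mx W).
  rewrite colE -mulmxA -colE col_basis_mx Pid //.
  by rewrite vbasis_mem // mem_nth // size_tuple.
by move/matrixP/(_ i 0); rewrite !mxE.
Qed.

(** * Dimensions of the eigenspaces from traces *)

Section CyclicDimension.
Context {R : realType}.

(** The product of the two cosines splits into cosines of index [k + 1] and [k - 1]. By
    orthogonality their sums over [j] detect [k = n.-1] and [k = 1]. *)
Lemma trace_cyc_avg n d (G : 'M[R]_d) a q k :
  (2 < n)%N -> d = (2 * (a + n * q))%N ->
  (forall j, (0 < j < n)%N -> \tr (G ^+ j) = a%:R * (2 * cos (j%:R * angle n))) ->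
  (k < n)%N ->
  \tr (cyc_avg n G k) = (2 * q + a * ((k == 1) + (k == n.-1)))%:R.
Proof.
move=> n2 dE trG kn; have n0 : (0 < n)%N by exact: ltn_trans n2.
have nR0 : n%:R != 0 :> R by rewrite pnatr_eq0 -lt0n.
(* At [j = 0] the trace is the whole dimension; the second summand is its excess over the formula
   valid for [0 < j < n]. *)
pose T (j : nat) : R := a%:R * (2 * cos (j%:R * angle n)) + (2 * (n * q))%:R *+ (j == 0)%N.
have trT (j : 'I_n) : \tr (G ^+ j) = T j.
  rewrite /T; case: (posnP j) => [->|j0]; last first.
    by rewrite trG ?j0 ?ltn_ord // addr0.
  by rewrite expr0 mxtrace1 mul0r cos0 dE !(natrM, natrD) mulr1n; ring.
have S1 : \sum_(j < n) cos (j%:R * (k%:R * angle n)) * (2 * (n * q))%:R *+ (val j == 0)%N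
    = (2 * (n * q))%:R :> R.
  rewrite (bigD1 (Ordinal n0)) //= big1 => [|j j0]; last first.
    by rewrite (_ : (val j == 0)%N = false) ?mulr0n //; exact: negbTE j0.
  by rewrite mul0r cos0 mulr1n mul1r addr0.
have S2 : \sum_(j < n) (2 * cos (j%:R * (k%:R * angle n)) * cos (j%:R * angle n))
    = n%:R * ((k == 1) + (k == n.-1))%:R :> R.
  transitivity (\sum_(j < n) (cos (j%:R * (k.+1%:R * angle n)))
      + \sum_(j < n) cos (j%:R * ((k%:R - 1) * angle n)) : R).
    rewrite -big_split; apply: eq_bigr => j _ /=.
    have -> : j%:R * (k.+1%:R * angle n) = j%:R * (k%:R * angle n) + j%:R * angle n :> R.
      by rewrite -[k.+1%:R]natr1; ring.
    have -> : j%:R * ((k%:R - 1) * angle n) = j%:R * (k%:R * angle n) - j%:R * angle n :> R.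
      by ring.
    by rewrite cosD cosB; ring.
  have -> : \sum_(j < n) (cos (j%:R * (k.+1%:R * angle n))) = n%:R *+ (k == n.-1) :> R.
    have [kn1|kn1] := eqVneq k n.-1.
      rewrite kn1 prednK // natr_angle // mulr1n.
      rewrite (eq_bigr (fun=> 1)) ?sumr_const ?card_ord // => j _.
      by rewrite -[_ * _]add0r cos_nat_period cos0.
    by rewrite sum_cos_angle_eq ?mulr0n //; lia.
  have -> : \sum_(j < n) cos (j%:R * ((k%:R - 1) * angle n)) = n%:R *+ (k == 1)%N :> R.
    case: k {trT S1} kn => [|k] kn.
      rewrite (eq_bigr (fun j : 'I_n => cos (j%:R * (1%:R * angle n)))).
        by rewrite sum_cos_angle_eq //; lia.
      by move=> j _; rewrite sub0r mulNr mulrN cosN.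
    by rewrite -[k.+1%:R]natr1 addrK sum_cos_angle_eq //; lia.
  by rewrite addrC -mulrnDr [RHS]mulr_natr.
rewrite /cyc_avg mxtraceZ raddf_sum /=.
have -> : \sum_(j < n) \tr (cos (j%:R * (k%:R * angle n)) *: G ^+ j) =
   a%:R * (n%:R * ((k == 1) + (k == n.-1))%:R) + (2 * (n * q))%:R.
  rewrite -{1}S2 -S1 mulr_sumr -big_split /=; apply: eq_bigr => j _.
  rewrite mxtraceZ trT /T mulrDr; congr (_ + _); first by ring.
  by rewrite mulrnAr.
by rewrite !(natrM, natrD); field.
Qed.

Lemma sum_cyc_fold n l (f : nat -> nat) : (2 < n)%N -> (l <= n./2)%N ->
  (\sum_(k < n | cyc_fold n k == l) f k =
    if (l == 0) || (l.*2 == n) then f l else f l + f (n - l))%N.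
Proof.
move=> n2 ln; have l_lt : (l < n)%N by lia.
case: ifP => [h|/negbT h].
  rewrite (big_pred1 (Ordinal l_lt)) // => k /=; rewrite -val_eqE /= /cyc_fold.
  have := ltn_ord k; lia.
have nl_lt : (n - l < n)%N by lia.
rewrite (bigD1 (Ordinal l_lt)) /=; last by rewrite /cyc_fold; apply/eqP; lia.
congr (_ + _)%N; rewrite (big_pred1 (Ordinal nl_lt)) // => k /=.
by rewrite -!val_eqE /= /cyc_fold; have := ltn_ord k; lia.
Qed.

(** In the application [q] counts the free orbits of points under the rotation, which contribute
    evenly to all Fourier indices. The [a] fixed points carry the rotation of the plane itself,
    which lives in index 1 only. *)
Lemma dim_cyc_space n d (G : 'M[R]_d) a q l :
  (2 < n)%N -> d = (2 * (a + n * q))%N -> G ^+ n = 1 ->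
  (forall j, (0 < j < n)%N -> \tr (G ^+ j) = a%:R * (2 * cos (j%:R * angle n))) ->
  (l <= n./2)%N ->
  \dim (cyc_space n G l) =
    (if (l == 0) || (l.*2 == n) then 2 * q else 4 * q + 2 * (a * (l == 1)))%N.
Proof.
move=> n2 dE Gn trG ln.
have tr := @dim_proj_trace R d (cyc_proj n G l) (cyc_space n G l)
  (cyc_proj_mem n2 Gn l) (fun v => cyc_proj_id n2 Gn (v := v) (ln : (l < n./2.+1)%N)).
pose f k := (2 * q + a * ((k == 1) + (k == n.-1)))%N.
have : (\dim (cyc_space n G l))%:R = (\sum_(k < n | cyc_fold n k == l) f k)%:R :> R.
  rewrite tr /cyc_proj raddf_sum natr_sum /=; apply: eq_bigr => k _.
  by rewrite (trace_cyc_avg n2 dE).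
move/eqP; rewrite eqr_nat => /eqP ->; rewrite sum_cyc_fold // /f.
case: ifP => h; first by have -> : (l == 1) = false; lia.
case: (eqVneq l 1) => [->|l1]; first by lia.
have -> : (l == n.-1) = false by lia.
have -> : (n - l == 1)%N = false by lia.
by have -> : (n - l == n.-1)%N = false; lia.
Qed.

(** The indices equal to their own opposite modulo [n]: 0 and, for even [n], [n./2]. Only one
    average enters their projection, whence the halved dimension. *)
Definition simple_index n (i : nat) : nat := if i == 0 then 0 else n./2.

(** Stated for any commutative monoid because it regroups sums of subspaces, sums of dimensions and
    products of determinants. *)
Lemma big_cyc_index (T : Type) (idx : T) (op : Monoid.com_law idx) n (F : nat -> T) :
  (2 < n)%N ->
  op (op (\big[op/idx]_(i < (if odd n then 1 else 2)%N) F (simple_index n i))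
         (\big[op/idx]_(j < (if odd n then (n - 3)./2 else n./2 - 2)%N) F j.+2))
     (F 1%N) = \big[op/idx]_(k < n./2.+1) F k.
Proof.
move=> n2; case: ifP => on.
  have -> : n./2.+1 = ((n - 3)./2).+2 by lia.
  rewrite !big_ord_recl big_ord0 Monoid.mulm1 -Monoid.mulmA /simple_index /bump /=.
  by congr (op _ _); rewrite Monoid.mulmC.
have -> : n./2.+1 = (n./2 - 2).+3 by lia.
rewrite [RHS]big_ord_recr !big_ord_recl !big_ord0 Monoid.mulm1.
rewrite /simple_index /bump /= ?add1n (_ : (n./2 - 2).+2 = n./2); last by lia.
have key x y z : op x (op y z) = op z (op y x).
  by rewrite [op y z]Monoid.mulmC [LHS]Monoid.mulmCA [op y x]Monoid.mulmC.
by rewrite -!Monoid.mulmA; congr (op _ _); apply: key.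
Qed.

End CyclicDimension.

(** * First and second derivatives of the potential *)

Section Analysis1D.
Context {R : realType}.

Lemma derive_line d (f : 'cV[R]_d -> R) (v z : 'cV[R]_d) :
  'D_v f z = 'D_1 (fun h : R => f (h *: v + z)) 0.
Proof.
rewrite /derive.
suff -> : (fun h : R => h^-1 *: ((f \o shift z) (h *: v) - f z)) =
    (fun h : R => h^-1 *: (((fun h' : R => f (h' *: v + z)) \o shift 0) (h *: 1)
       - f (0 *: v + z))) by [].
apply/funext => h /=.
by rewrite scale0r add0r addr0 [h *: 1]mulr1.
Qed.

Lemma is_derive_sum_fun n (F : 'I_n -> R -> R) (t : R) (dF : 'I_n -> R) :
  (forall i, is_derive t 1 (F i) (dF i)) ->
  is_derive t 1 (fun h => \sum_(i < n) F i h) (\sum_(i < n) dF i).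
Proof.
move=> dFi; have -> : (fun h => \sum_(i < n) F i h) = \sum_(i < n) F i.
  by apply/funext => h; rewrite fct_sumE.
apply: is_derive_sum.
Qed.

Lemma is_derive_affine (a b t : R) : is_derive t 1 (fun h => h * a + b) a.
Proof.
have -> : (fun h => h * a + b) = (a \*: id) + cst b.
  by apply/funext => h /=; rewrite mulrC.
have h := is_deriveD (is_deriveZ a (is_derive_id t 1)) (is_derive_cst b t 1).
by apply: (is_derive_eq h); rewrite addr0 [a *: 1]mulr1.
Qed.

Lemma near_pos_derive (f : R -> R) (t df : R) : is_derive t 1 f df -> 0 < f t ->
  \forall h \near t, 0 < f h.
Proof.
move=> [fd _] ft.
have /derivable1_diffP/differentiable_continuous cf := fd.
exact: (cf _ (lt_nbhsr ft)).
Qed.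

(* The interaction of two points at squared distance u; [psi] is twice its derivative. *)
Definition pair_potential (gamma u : R) : R :=
  if gamma == -1 then - ln (Num.sqrt u)
  else (2 * gamma + 2)^-1 * (Num.sqrt u) `^ (2 * gamma + 2).

Definition psi (gamma u : R) : R := (if gamma == -1 then -1 else 1) * u `^ gamma.
Definition dpsi (gamma u : R) : R :=
  (if gamma == -1 then -1 else 1) * (gamma * u `^ (gamma - 1)).

Lemma is_derive_psi gamma (u : R) : 0 < u ->
  is_derive u 1 (psi gamma) (dpsi gamma u).
Proof.
move=> u0; have dp := is_derive1_powR gamma u0.
have := is_deriveZ (if gamma == -1 then -1 else 1 : R) dp; exact.
Qed.

(** Euler's relation for [psi], homogeneous of degree [gamma]; it yields the homogeneity of the
    force. *)
Lemma mul_dpsi gamma (u : R) : 0 < u -> u * dpsi gamma u = gamma * psi gamma u.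
Proof.
move=> u0; rewrite /dpsi /psi.
have -> : u `^ gamma = u * u `^ (gamma - 1).
  by rewrite -{2}[u]powRr1 ?ltW // -powRD ?(gt_eqF u0) ?implybT // addrC subrK.
ring.
Qed.

(** Near [u > 0] the square root disappears: the function is [- ln u / 2] in the vortex case and
    [u ^ (gamma + 1) / (2 * gamma + 2)] otherwise. *)
Lemma is_derive_pair_potential gamma (u : R) : 0 < u ->
  is_derive u 1 (pair_potential gamma) (psi gamma u / 2).
Proof.
move=> u0; have near0 : \forall t \near u, 0 < t by exact: lt_nbhsr.
rewrite /pair_potential /psi; case: (eqVneq gamma (-1)) => [->|g1].
  have e : \near u, ((- (2^-1)) \*: @ln R) u = - ln (Num.sqrt u).
    near=> t; have t0 : 0 < t by near: t.
    by rewrite -powR12_sqrt ?ltW // ln_powR /= -mulNr.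
  have h := is_deriveZ (- 2^-1) (is_derive1_ln u0).
  apply: (near_eq_is_derive e); apply: (is_derive_eq h).
  by rewrite powR_inv1 ?ltW // mulN1r mulNr [- _ *: _]mulNr mulrC.
have g0 : 2 * gamma + 2 != 0 by apply: contra_neq g1 => h; lra.
have e : \near u, ((2 * gamma + 2)^-1 \*: (@powR R)^~ (gamma + 1)) u
     = (2 * gamma + 2)^-1 * (Num.sqrt u) `^ (2 * gamma + 2).
  near=> t; have t0 : 0 < t by near: t.
  rewrite -powR12_sqrt ?ltW // -powRrM /=; by congr (_ * _ `^ _); field.
have h := is_deriveZ (2 * gamma + 2)^-1 (is_derive1_powR (gamma + 1) u0).
apply: (near_eq_is_derive e); apply: (is_derive_eq h).
rewrite addrK mul1r [_ *: _]mulrA; field.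
Unshelve. all: by end_near.
Qed.

End Analysis1D.

(** * Force and linearized force *)

Section Potential.
Context {R : realType} {N : nat}.
Variables (gamma : R) (m : 'I_N -> R).
Implicit Types (u v w y z x : 'cV[R]_(N * 2)) (i j : 'I_N).

Definition dot (p q : 'cV[R]_2) : R := \sum_k p k 0 * q k 0.

Definition of_pos (F : 'I_N -> 'cV[R]_2) : 'cV[R]_(N * 2) :=
  \col_k F (mxtens_unindex k).1 (mxtens_unindex k).2 0.

Lemma pos_of_pos F i : pos (of_pos F) i = F i.
Proof. by apply/matrixP => k l; rewrite !mxE mxtens_indexK ord1. Qed.

Lemma pos_eqP u v : (forall i, pos u i = pos v i) -> u = v.
Proof.
move=> uv; apply/matrixP => k l; rewrite ord1.
have /matrixP/(_ (mxtens_unindex k).2 0) := uv (mxtens_unindex k).1.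
by rewrite !mxE -surjective_pairing mxtens_unindexK.
Qed.

Lemma pos_entry u i k : pos u i k 0 = u (mxtens_index (i, k)) 0.
Proof. by rewrite mxE. Qed.

Lemma posD u v i : pos (u + v) i = pos u i + pos v i.
Proof. by apply/matrixP => k l; rewrite !mxE. Qed.

Lemma posZ (a : R) u i : pos (a *: u) i = a *: pos u i.
Proof. by apply/matrixP => k l; rewrite !mxE. Qed.

Definition dpos y i j : 'cV[R]_2 := pos y i - pos y j.

Lemma dpos_line (h : R) v y i j : dpos (h *: v + y) i j = h *: dpos v i j + dpos y i j.
Proof. by rewrite /dpos !posD !posZ scalerBr addrACA opprD. Qed.

Lemma dposC y i j : dpos y j i = - dpos y i j.
Proof. by rewrite /dpos opprB. Qed.

Lemma dposii y i : dpos y i i = 0.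
Proof. by rewrite /dpos subrr. Qed.

Lemma dotC p q : dot p q = dot q p.
Proof. by apply: eq_bigr => k _; rewrite mulrC. Qed.

Lemma dotDl p p' q : dot (p + p') q = dot p q + dot p' q.
Proof. by rewrite -big_split; apply: eq_bigr => k _; rewrite mxE mulrDl. Qed.

Lemma dotZl a p q : dot (a *: p) q = a * dot p q.
Proof. by rewrite mulr_sumr; apply: eq_bigr => k _; rewrite mxE mulrA. Qed.

Lemma dotDr p q q' : dot p (q + q') = dot p q + dot p q'.
Proof. by rewrite dotC dotDl !(dotC _ p). Qed.

Lemma dotZr a p q : dot p (a *: q) = a * dot p q.
Proof. by rewrite dotC dotZl dotC. Qed.

Lemma dotNl p q : dot (- p) q = - dot p q.
Proof. by rewrite -scaleN1r dotZl mulN1r. Qed.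

Lemma dotNr p q : dot p (- q) = - dot p q.
Proof. by rewrite dotC dotNl dotC. Qed.

Lemma dot0l q : dot 0 q = 0.
Proof. by rewrite -(scale0r 0) dotZl mul0r. Qed.

Lemma dot_suml I (r : seq I) P (F : I -> 'cV[R]_2) q :
  dot (\sum_(i <- r | P i) F i) q = \sum_(i <- r | P i) dot (F i) q.
Proof. by apply: (big_morph (fun p => dot p q) (fun p p' => dotDl p p' q) (dot0l q)). Qed.

Lemma dot_gt0 p : p != 0 -> 0 < dot p p.
Proof.
move=> p0; have : 0 <= dot p p by apply: sumr_ge0 => k _; rewrite -expr2 sqr_ge0.
rewrite le_eqVlt => /orP[/eqP|//] h; case/negP: p0; apply/eqP/matrixP => k l.
rewrite ord1 mxE; apply/eqP; rewrite -sqrf_eq0.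
have := esym h; move/eqP; rewrite psumr_eq0; last by move=> i _; rewrite -expr2 sqr_ge0.
by move/allP/(_ k); rewrite mem_index_enum => /(_ isT); rewrite -expr2.
Qed.

Definition sqdist y i j : R := dot (dpos y i j) (dpos y i j).

Lemma sqdistC y i j : sqdist y j i = sqdist y i j.
Proof. by rewrite /sqdist dposC dotNl dotNr opprK. Qed.

Lemma sqdist_gt0 y i j : injective (pos y) -> i != j -> 0 < sqdist y i j.
Proof.
move=> yi ij; apply: dot_gt0; rewrite subr_eq0; apply: contra ij.
by move=> /eqP/yi ->.
Qed.

Lemma potentialE y : potential gamma m y =
  \sum_(i < N) \sum_(j < N | (i < j)%N) m i * m j * pair_potential gamma (sqdist y i j).
Proof.
have en i j : enorm (pos y i - pos y j) = Num.sqrt (sqdist y i j).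
  by rewrite /enorm; congr Num.sqrt; apply: eq_bigr => k _; rewrite expr2.
rewrite /potential /pair_potential; case: ifP => g1.
  rewrite /vortex_potential -sumrN; apply: eq_bigr => i _.
  by rewrite -sumrN; apply: eq_bigr => j _; rewrite en mulrN.
rewrite /body_potential mulr_sumr; apply: eq_bigr => i _.
by rewrite mulr_sumr; apply: eq_bigr => j _; rewrite en mulrCA.
Qed.

Lemma is_derive_sqdist v y i j :
  is_derive (0 : R) 1 (fun h : R => sqdist (h *: v + y) i j)
    (2 * dot (dpos y i j) (dpos v i j)).
Proof.
have -> : (fun h : R => sqdist (h *: v + y) i j) =
    (fun h => dot (h *: dpos v i j + dpos y i j) (h *: dpos v i j + dpos y i j)).
  by apply/funext => h; rewrite /sqdist dpos_line.
move: (dpos y i j) (dpos v i j) => d e.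
have -> : (fun h : R => dot (h *: e + d) (h *: e + d)) =
    (fun h => h * dot e e + 2 * dot d e) * id + cst (dot d d).
  apply/funext => h; rewrite !(dotDl, dotDr, dotZl, dotZr) (dotC e d).
  by transitivity ((h * dot e e + 2 * dot d e) * h + dot d d); [ring|].
have h1 := is_derive_affine (dot e e) (2 * dot d e) 0.
have h2 := is_deriveD (is_deriveM h1 (is_derive_id (0 : R) (1 : R))) (is_derive_cst (dot d d) (0 : R) (1 : R)).
apply: (is_derive_eq h2).
by rewrite mul0r add0r addr0 [_ *: 1]mulr1 [id 0 *: _]mul0r addr0.
Qed.

Lemma near_sqdist_gt0 v y : injective (pos y) ->
  \forall h \near (0 : R), injective (pos (h *: v + y)).
Proof.
move=> yi.
have H : \forall h \near (0 : R), forall i j, i != j -> 0 < sqdist (h *: v + y) i j.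
  apply: (@filter_forall _ _ (fun i h => forall j, i != j -> 0 < sqdist (h *: v + y) i j) _ (nbhs_filter _)) => i.
  apply: (@filter_forall _ _ (fun j h => i != j -> 0 < sqdist (h *: v + y) i j) _ (nbhs_filter _)) => j.
  have [->|ij] := eqVneq i j; first by apply: nearW.
  have := @near_pos_derive R _ _ _ (is_derive_sqdist v y i j).
  rewrite scale0r add0r => /(_ (sqdist_gt0 yi ij)).
  by apply: filterS.
apply: filterS H => h H i j ij; apply/eqP; apply: contraT => /H.
by rewrite /sqdist /dpos ij subrr dot0l ltxx.
Qed.

(* The term j = i is zero, whatever the value of [psi gamma 0]. *)
Definition force y : 'cV[R]_(N * 2) :=
  of_pos (fun i => \sum_j (m i * m j * psi gamma (sqdist y i j)) *: dpos y i j).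

Lemma derive_potential v y : injective (pos y) ->
  'D_v (potential gamma m) y = \sum_i dot (pos (force y) i) (pos v i).
Proof.
move=> yi; rewrite derive_line.
pose c i j := m i * m j * psi gamma (sqdist y i j).
have -> : 'D_1 (fun h : R => potential gamma m (h *: v + y)) 0 =
    \sum_(i < N) \sum_(j < N | (i < j)%N) c i j * dot (dpos y i j) (dpos v i j).
  apply: derive_val.
  have -> : (fun h : R => potential gamma m (h *: v + y)) = (fun h : R =>
      \sum_(i < N) \sum_(j < N) if (i < j)%N then
         m i * m j * pair_potential gamma (sqdist (h *: v + y) i j) else 0).
    apply/funext => h; rewrite potentialE; apply: eq_bigr => i _.
    by rewrite big_mkcond.
  apply: is_derive_sum_fun => i; rewrite big_mkcond; apply: is_derive_sum_fun => j.
  case: ifP => ij; last exact: is_derive_cst.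
  have ij' : i != j by rewrite neq_ltn ij.
  have s0 := sqdist_gt0 yi ij'.
  have h1 := is_derive_sqdist v y i j.
  have h2 : is_derive (sqdist (0 *: v + y) i j) 1 (pair_potential gamma)
       (psi gamma (sqdist y i j) / 2).
    by rewrite scale0r add0r; exact: is_derive_pair_potential.
  have h3 := is_deriveZ (m i * m j) (is_derive1_comp h2 h1).
  apply: (is_derive_eq h3).
  by rewrite /c /GRing.scale /=; field.
have -> : \sum_i dot (pos (force y) i) (pos v i) =
    \sum_i \sum_j c i j * dot (dpos y i j) (pos v i).
  apply: eq_bigr => i _; rewrite pos_of_pos dot_suml; apply: eq_bigr => j _.
  by rewrite dotZl.
(* Since [dpos] is antisymmetric, the term of a pair is the work on [i] plus the work on [j]. The
   sum over [i < j] thus becomes the sum over all ordered pairs, whose diagonal is zero. *)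
pose t i j := c i j * dot (dpos y i j) (pos v i).
have ct i j : c i j * dot (dpos y i j) (dpos v i j) = t i j + t j i.
  rewrite /t /c {2}/dpos dotDr dotNr sqdistC (dposC _ i j) dotNl; ring.
under eq_bigr => i _ do under eq_bigr => j _ do rewrite ct.
under eq_bigr => i _ do rewrite big_split /=.
rewrite big_split /= [X in _ + X](exchange_big_dep xpredT) //= -big_split /=.
apply: eq_bigr => i _; rewrite [RHS](bigID (fun j : 'I_N => (i < j)%N)) /=; congr (_ + _).
rewrite (bigID (fun j : 'I_N => j == i)) /= [X in _ = X](bigID (fun j : 'I_N => j == i)) /=.
congr (_ + _).
  rewrite !big1 // => j /andP[h1 /eqP ji]; first by rewrite /t ji dposii dot0l mulr0.
  by rewrite -ji ltnn in h1.
by apply: eq_bigl => j; rewrite -leqNgt (leq_eqVlt j i) -val_eqE /=; case: ltngtP.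
Qed.

Lemma gradient_potential y : injective (pos y) ->
  gradient (potential gamma m) y = force y.
Proof.
move=> yi; apply/matrixP => k l; rewrite ord1 mxE derive_potential //.
have [i0 r0] := mxtens_indexP k.
rewrite (bigD1 i0) //= [X in _ + X]big1 => [|i ik].
  rewrite addr0 /dot (bigD1 r0) //= big1 => [|r rk].
    by rewrite !pos_entry [delta_mx _ _ _ _]mxE !eqxx mulr1 addr0.
  rewrite !pos_entry [delta_mx _ _ _ _]mxE (_ : (_ == _) = false) ?mulr0 //.
  by apply: contraNF rk => /eqP/(can_inj (@mxtens_indexK _ _))[] ->.
rewrite /dot big1 // => r _.
rewrite !pos_entry [delta_mx _ _ _ _]mxE (_ : (_ == _) = false) ?mulr0 //.
by apply: contraNF ik => /eqP/(can_inj (@mxtens_indexK _ _))[] ->.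
Qed.

Definition dforce y v : 'cV[R]_(N * 2) :=
  of_pos (fun i => \sum_j (m i * m j) *:
    (psi gamma (sqdist y i j) *: dpos v i j +
     (2 * dpsi gamma (sqdist y i j) * dot (dpos y i j) (dpos v i j)) *: dpos y i j)).

Lemma derive_force v y k : injective (pos y) ->
  'D_1 (fun h : R => force (h *: v + y) k 0) 0 = dforce y v k 0.
Proof.
move=> yi; apply: derive_val.
have [i r] := mxtens_indexP k; rewrite mxE mxtens_indexK /= summxE.
have -> : (fun h : R => force (h *: v + y) (mxtens_index (i, r)) 0) = (fun h =>
    \sum_j (m i * m j) * (psi gamma (sqdist (h *: v + y) i j) *
        (h * dpos v i j r 0 + dpos y i j r 0))).
  apply/funext => h; rewrite mxE mxtens_indexK /= summxE; apply: eq_bigr => j _.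
  by rewrite mxE dpos_line !mxE !mulrA.
apply: is_derive_sum_fun => j.
(* On the diagonal [psi] is evaluated at 0, where it may fail to be differentiable, but the factor
   [dpos] is identically zero. *)
have [<-|ij] := eqVneq i j.
  rewrite !dposii.
  have -> : (fun h : R => m i * m i * (psi gamma (sqdist (h *: v + y) i i) *
      (h * (0 : 'cV[R]_2) r 0 + (0 : 'cV[R]_2) r 0))) = cst 0.
    by apply/funext => h; rewrite !mxE mulr0 addr0 !mulr0.
  by rewrite !scaler0 addr0 scaler0 mxE; exact: is_derive_cst.
have s0 := sqdist_gt0 yi ij.
have h1 := is_derive_sqdist v y i j.
have h2 : is_derive (sqdist (0 *: v + y) i j) 1 (psi gamma) (dpsi gamma (sqdist y i j)).
  by rewrite scale0r add0r; exact: is_derive_psi.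
have h3 := is_derive1_comp h2 h1.
have h4 := is_derive_affine (dpos v i j r 0) (dpos y i j r 0) 0.
have h5 := is_deriveZ (m i * m j) (is_deriveM h3 h4).
apply: (is_derive_eq h5).
rewrite /= scale0r add0r mul0r add0r !mxE /GRing.scale /=; ring.
Qed.

Lemma dforceD y v w : dforce y (v + w) = dforce y v + dforce y w.
Proof.
apply: pos_eqP => i; rewrite posD !pos_of_pos -big_split; apply: eq_bigr => j _ /=.
rewrite -scalerDr; congr (_ *: _); have -> : dpos (v + w) i j = dpos v i j + dpos w i j.
  by rewrite -[v]scale1r dpos_line !scale1r.
rewrite (dotDr (dpos y i j) (dpos v i j)).
move: (dpos v i j) (dpos w i j) (dpos y i j) (dot _ (dpos v i j)) (dot _ (dpos w i j)).
by move=> p q r s t; apply/matrixP => k l; rewrite !mxE; ring.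
Qed.

Lemma dforceZ y (a : R) v : dforce y (a *: v) = a *: dforce y v.
Proof.
apply: pos_eqP => i; rewrite posZ !pos_of_pos scaler_sumr; apply: eq_bigr => j _ /=.
have -> : dpos (a *: v) i j = a *: dpos v i j.
  by rewrite /dpos !posZ -scalerBr.
rewrite dotZr; move: (dpos v i j) (dpos y i j) (dot _ _) => p q t.
by apply/matrixP => r l; rewrite !mxE; ring.
Qed.

(** [gradient] is known to equal [force] only at configurations without collision; these include all
    points of a line close to [y], which is enough to differentiate. Linearity of [dforce] then
    passes from basis vectors to [v]. *)
Lemma hessian_mul y v : injective (pos y) ->
  hessian (potential gamma m) y *m v = dforce y v.
Proof.
move=> yi.
have hE k l : hessian (potential gamma m) y k l = dforce y (delta_mx l 0) k 0.
  rewrite mxE derive_line -derive_force //; apply: near_eq_derive.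
  apply: filterS (near_sqdist_gt0 (delta_mx l 0) yi) => h hi.
  by rewrite gradient_potential.
have d0 : dforce y 0 = 0 by rewrite -(scale0r 0) dforceZ !scale0r.
rewrite {2}[v]matrix_sum_delta.
under eq_bigr => k _ do rewrite big_ord1.
rewrite (big_morph _ (dforceD y) d0); apply/matrixP => k l; rewrite ord1 mxE summxE.
by apply: eq_bigr => i _; rewrite hE dforceZ [RHS]mxE mulrC.
Qed.

End Potential.

(** * Symmetries of a configuration *)

Section PlaneMatrices.
Context {R : realType}.
Implicit Types t : R.

Definition Jplane : 'M[R]_2 := mx2 0 (-1) 1 0.

Lemma ord2_cases (i : 'I_2) : (i == 0) || (i == 1).
Proof. by case: i => [[|[|?]] ?]. Qed.

Lemma mx2_eq (A B : 'M[R]_2) : A 0 0 = B 0 0 -> A 0 1 = B 0 1 ->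
  A 1 0 = B 1 0 -> A 1 1 = B 1 1 -> A = B.
Proof.
move=> h00 h01 h10 h11; apply/matrixP => i j.
by case/orP: (ord2_cases i) => /eqP ->; case/orP: (ord2_cases j) => /eqP ->.
Qed.

Lemma mx2M (a b c d a' b' c' d' : R) : mx2 a b c d *m mx2 a' b' c' d' =
  mx2 (a * a' + b * c') (a * b' + b * d') (c * a' + d * c') (c * b' + d * d').
Proof. by apply: mx2_eq; rewrite !mxE !big_ord_recl big_ord0 !mxE /= addr0. Qed.

Lemma mx2_1 : mx2 1 0 0 1 = 1%:M :> 'M[R]_2.
Proof. by apply: mx2_eq; rewrite !mxE. Qed.

Lemma mx2N (a b c d : R) : - mx2 a b c d = mx2 (- a) (- b) (- c) (- d).
Proof. by apply: mx2_eq; rewrite !mxE. Qed.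

Lemma mx2D (a b c d a' b' c' d' : R) : mx2 a b c d + mx2 a' b' c' d' =
  mx2 (a + a') (b + b') (c + c') (d + d').
Proof. by apply: mx2_eq; rewrite !mxE. Qed.

Lemma Jplane2 : Jplane *m Jplane = - 1%:M.
Proof. by rewrite -mx2_1 mx2N mx2M; congr mx2; ring. Qed.

Lemma rotation0 : rotation 0 = 1%:M :> 'M[R]_2.
Proof. by rewrite /rotation cos0 sin0 oppr0 mx2_1. Qed.

Lemma rotationD t s : rotation t *m rotation s = rotation (t + s).
Proof. by rewrite /rotation mx2M cosD sinD; congr mx2; ring. Qed.

Lemma rotationX t k : rotation t ^+ k = rotation (k%:R * t).
Proof.
elim: k => [|k IH]; first by rewrite mul0r rotation0.
rewrite exprS IH [LHS]rotationD; congr rotation.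
by rewrite -natr1 mulrDl mul1r addrC.
Qed.

Lemma rotation_2pi : rotation (2 * pi) = 1%:M :> 'M[R]_2.
Proof. by rewrite /rotation [2 * pi]mulr_natl cos2pi sin2pi oppr0 mx2_1. Qed.

Lemma rotationJ t : Jplane *m rotation t = rotation t *m Jplane.
Proof. by rewrite /rotation !mx2M; congr mx2; ring. Qed.

Lemma reflectionJ t : Jplane *m reflection t = - (reflection t *m Jplane).
Proof. by rewrite /reflection !mx2M mx2N; congr mx2; ring. Qed.

Lemma reflection2 t : reflection t *m reflection t = 1%:M.
Proof.
rewrite /reflection mx2M -mx2_1; move: (2 * t) => u.
by congr mx2; rewrite -?(cos2Dsin2 u); ring.
Qed.

(** The product of a reflection and a rotation is a reflection, hence an involution. *)
Lemma reflection_rotation t s :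
  reflection t *m rotation s *m reflection t *m rotation s = 1%:M.
Proof.
have e : reflection t *m rotation s = reflection (t - s / 2).
  rewrite /reflection /rotation mx2M.
  have -> : 2 * (t - s / 2) = 2 * t - s by field.
  by rewrite cosB sinB; congr mx2; ring.
by rewrite -mulmxA e reflection2.
Qed.

Lemma tr_rotation t : \tr (rotation t) = 2 * cos t.
Proof. by rewrite /mxtrace !big_ord_recl big_ord0 !mxE /=; ring. Qed.

Lemma dotE (p q : 'cV[R]_2) : dot p q = p 0 0 * q 0 0 + p 1 0 * q 1 0.
Proof.
rewrite /dot !big_ord_recl big_ord0 addr0.
by have -> : lift 0 0 = 1 :> 'I_2 by apply/val_inj.
Qed.

Lemma mul_mx2_0 (a b c d : R) (p : 'cV[R]_2) :
  (mx2 a b c d *m p) 0 0 = a * p 0 0 + b * p 1 0.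
Proof.
rewrite mxE !big_ord_recl big_ord0 addr0 !mxE.
by have -> : lift 0 0 = 1 :> 'I_2 by apply/val_inj.
Qed.

Lemma mul_mx2_1 (a b c d : R) (p : 'cV[R]_2) :
  (mx2 a b c d *m p) 1 0 = c * p 0 0 + d * p 1 0.
Proof.
rewrite mxE !big_ord_recl big_ord0 addr0 !mxE.
by have -> : lift 0 0 = 1 :> 'I_2 by apply/val_inj.
Qed.

Lemma dot_mx2 (a b c d : R) (p q : 'cV[R]_2) :
  a ^+ 2 + c ^+ 2 = 1 -> b ^+ 2 + d ^+ 2 = 1 -> a * b + c * d = 0 ->
  dot (mx2 a b c d *m p) (mx2 a b c d *m q) = dot p q.
Proof.
move=> h1 h2 h3; rewrite !dotE !mul_mx2_0 !mul_mx2_1.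
move: (p 0 0) (p 1 0) (q 0 0) (q 1 0) => p0 p1 q0 q1.
transitivity ((a ^+ 2 + c ^+ 2) * (p0 * q0) + (b ^+ 2 + d ^+ 2) * (p1 * q1)
   + (a * b + c * d) * (p0 * q1 + p1 * q0)); first by ring.
by rewrite h1 h2 h3; ring.
Qed.

Lemma dot_rotation t p q : dot (rotation t *m p) (rotation t *m q) = dot p q.
Proof.
apply: dot_mx2; rewrite ?sqrrN ?cos2Dsin2 //; last by ring.
by rewrite addrC cos2Dsin2.
Qed.

Lemma dot_reflection t p q : dot (reflection t *m p) (reflection t *m q) = dot p q.
Proof.
apply: dot_mx2; rewrite ?sqrrN ?cos2Dsin2 //; last by ring.
by rewrite addrC cos2Dsin2.
Qed.

Lemma dot_Jplane (p : 'cV[R]_2) : dot p (Jplane *m p) = 0.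
Proof. by rewrite dotE mul_mx2_0 mul_mx2_1; ring. Qed.

(** The determinant of [rotation t - 1] is [2 * (1 - cos t)]. *)
Lemma rotation_fix t (p : 'cV[R]_2) : cos t != 1 -> rotation t *m p = p -> p = 0.
Proof.
move=> c1 /matrixP Qp; have := Qp 0 0; have := Qp 1 0.
rewrite mul_mx2_0 mul_mx2_1.
set p0 := p 0 0; set p1 := p 1 0 => h1 h0.
have c1' : 1 - cos t != 0 by rewrite subr_eq0 eq_sym.
have cs := cos2Dsin2 t.
have e0 : (1 - cos t) * p0 = 0 by nra.
have e1 : (1 - cos t) * p1 = 0 by nra.
move/eqP: e0; rewrite mulf_eq0 (negbTE c1') => /eqP z0.
move/eqP: e1; rewrite mulf_eq0 (negbTE c1') => /eqP z1.
apply/matrixP => i j; rewrite ord1 mxE.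
by case/orP: (ord2_cases i) => /eqP ->.
Qed.

End PlaneMatrices.

Section ProductAction.
Context {R : realType} {N : nat}.
Implicit Types (u v w x : 'cV[R]_(N * 2)) (Q : 'M[R]_2) (tau : 'S_N).

Lemma mulmx_eqP d e (A B : 'M[R]_(d, e)) :
  (forall v : 'cV_e, A *m v = B *m v) -> A = B.
Proof.
move=> AB; apply/matrixP => i j.
by have /matrixP/(_ i 0) := AB (delta_mx j 0); rewrite -!colE !mxE.
Qed.

Lemma pos_tensmx (D : 'M[R]_N) Q v i :
  pos ((D *t Q) *m v) i = \sum_j D i j *: (Q *m pos v j).
Proof.
apply/matrixP => k l; rewrite ord1 pos_entry mxE summxE.
have -> : \sum_j (D *t Q) (mxtens_index (i, k)) j * v j 0 =
    \sum_j \sum_r D i j * Q k r * v (mxtens_index (j, r)) 0.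
  rewrite pair_big /= (reindex (@mxtens_index N 2)) /=.
    by apply: eq_bigr => -[j r] _; rewrite tensmxE.
  exists (@mxtens_unindex N 2) => ? _; [exact: mxtens_indexK|exact: mxtens_unindexK].
apply: eq_bigr => j _; rewrite !mxE mulr_sumr; apply: eq_bigr => r _.
by rewrite mxE mulrA.
Qed.

Lemma mxtrace_tensmx (D : 'M[R]_N) Q : \tr (D *t Q) = \tr D * \tr Q.
Proof.
rewrite /mxtrace (reindex (@mxtens_index N 2)) /=; last first.
  exists (@mxtens_unindex N 2) => ? _; [exact: mxtens_indexK|exact: mxtens_unindexK].
rewrite mulr_suml; under [RHS]eq_bigr => i _ do rewrite mulr_sumr.
by rewrite pair_big /=; apply: eq_bigr => -[j r] _; rewrite tensmxE.
Qed.

Lemma tensmxN (D : 'M[R]_N) Q : D *t (- Q) = - (D *t Q).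
Proof.
apply/matrixP => k l; have [[i r] [j s]] := (mxtens_indexP k, mxtens_indexP l).
by rewrite [RHS]mxE !tensmxE mxE mulrN.
Qed.

Lemma pos_massmx (m : 'I_N -> R) v i : pos (massmx m *m v) i = m i *: pos v i.
Proof.
rewrite pos_tensmx (bigD1 i) //= big1 => [|j ji].
  by rewrite addr0 mul1mx !mxE eqxx mulr1n.
by rewrite !mxE eq_sym (negbTE ji) mulr0n scale0r.
Qed.

Lemma massmx_unit (m : 'I_N -> R) : (forall i, m i != 0) -> massmx m \in unitmx.
Proof.
move=> m0; apply: (proj1 (@mulmx1_unit _ _ _ (massmx (fun i => (m i)^-1)) _)).
apply: mulmx_eqP => v; rewrite -mulmxA mul1mx; apply: pos_eqP => i.
by rewrite !pos_massmx scalerA mulfV // scale1r.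
Qed.

Lemma pos_Jmx v i : pos (@Jmx R N *m v) i = Jplane *m pos v i.
Proof.
rewrite pos_tensmx (bigD1 i) //= big1 => [|j ji].
  by rewrite addr0 !mxE eqxx scale1r.
by rewrite !mxE eq_sym (negbTE ji) scale0r.
Qed.

Lemma Jmx2 : @Jmx R N *m @Jmx R N = - 1%:M.
Proof.
apply: mulmx_eqP => v; apply: pos_eqP => i.
rewrite -mulmxA !pos_Jmx mulmxA Jplane2 !mulNmx !mul1mx.
by apply/matrixP => k l; rewrite !mxE.
Qed.

(** As a Kronecker product, its trace is a product of traces, and commutation with [Jmx] is decided
    by the plane factor [Q]. *)
Definition actmx tau Q : 'M[R]_(N * 2) := perm_mx tau *t Q.

Lemma pos_actmx tau Q v i : pos (actmx tau Q *m v) i = Q *m pos v (tau i).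
Proof.
rewrite pos_tensmx (bigD1 (tau i)) //= big1 => [|j ji].
  by rewrite addr0 !mxE eqxx scale1r.
by rewrite !mxE (negbTE (_ : tau i != j)) ?scale0r // eq_sym.
Qed.

Lemma actmxM tau tau' Q Q' :
  actmx tau Q *m actmx tau' Q' = actmx (tau * tau')%g (Q *m Q').
Proof. by rewrite /actmx tensmx_mul perm_mxM. Qed.

Lemma actmx1 : actmx 1%g 1%:M = 1%:M.
Proof.
apply: mulmx_eqP => v; apply: pos_eqP => i.
by rewrite pos_actmx perm1 !mul1mx.
Qed.

Lemma actmxX tau Q k : actmx tau Q ^+ k = actmx (tau ^+ k)%g (Q ^+ k).
Proof.
elim: k => [|k IH]; first by rewrite !expr0 expg0 actmx1.
by rewrite !exprS IH [LHS]actmxM expgS.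
Qed.

Lemma mxtrace_actmx tau Q :
  \tr (actmx tau Q) = #|[set i | tau i == i]%SET|%:R * \tr Q.
Proof.
rewrite mxtrace_tensmx; congr (_ * _); rewrite /mxtrace -sum1_card natr_sum [RHS]big_mkcond /=.
by apply: eq_bigr => i _; rewrite !mxE inE; case: eqP.
Qed.

Lemma Jmx_actmx tau Q : Jplane *m Q = Q *m Jplane ->
  @Jmx R N *m actmx tau Q = actmx tau Q *m @Jmx R N.
Proof. by move=> JQ; rewrite /Jmx /actmx !tensmx_mul mul1mx mulmx1 -/Jplane JQ. Qed.

Lemma Jmx_actmxN tau Q : Jplane *m Q = - (Q *m Jplane) ->
  @Jmx R N *m actmx tau Q = - (actmx tau Q *m @Jmx R N).
Proof. by move=> JQ; rewrite /Jmx /actmx !tensmx_mul mul1mx mulmx1 -/Jplane JQ tensmxN. Qed.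

(* [tau] is the inverse of the permutation of the indices induced by [Q]. *)
Definition is_symmetry x tau Q : Prop := forall i, pos x i = Q *m pos x (tau i).

Lemma is_symmetryM x tau Q tau' Q' :
  is_symmetry x tau Q -> is_symmetry x tau' Q' ->
  is_symmetry x (tau * tau')%g (Q *m Q').
Proof. by move=> s s' i; rewrite s s' mulmxA permM. Qed.

Lemma is_symmetry1 x tau : injective (pos x) -> is_symmetry x tau 1%:M -> tau = 1%g.
Proof. by move=> xi s; apply/permP => i; rewrite perm1; apply: xi; rewrite [RHS]s mul1mx. Qed.

Lemma is_symmetryX x tau Q k : is_symmetry x tau Q -> is_symmetry x (tau ^+ k)%g (Q ^+ k).
Proof.
move=> s; elim: k => [|k IH]; first by rewrite expg0 expr0 => i; rewrite perm1 mul1mx.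
by rewrite expgS exprS; exact: is_symmetryM.
Qed.

(** Lifts relations between plane matrices to configurations: distinct points leave no freedom for
    the permutation. *)
Lemma symmetry_actmx1 x tau : injective (pos x) -> is_symmetry x tau 1%:M ->
  actmx tau 1%:M = 1%:M.
Proof. by move=> xi /(is_symmetry1 xi) ->; exact: actmx1. Qed.

Lemma actmx_id x tau Q : is_symmetry x tau Q -> actmx tau Q *m x = x.
Proof. by move=> s; apply: pos_eqP => i; rewrite pos_actmx -s. Qed.

Lemma mulmx_dpos x tau Q i j : dpos (actmx tau Q *m x) i j = Q *m dpos x (tau i) (tau j).
Proof. by rewrite /dpos !pos_actmx mulmxBr. Qed.

Lemma pos_translation (v : 'cV[R]_2) (i : 'I_N) : pos (translation v) i = v.
Proof. by apply/matrixP => k l; rewrite !mxE mxtens_indexK ord1. Qed.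

Lemma actmx_translation tau Q (v : 'cV[R]_2) :
  actmx tau Q *m translation v = translation (Q *m v).
Proof. by apply: pos_eqP => i; rewrite pos_actmx !pos_translation. Qed.

End ProductAction.

(** * The matrix A at a relative equilibrium *)

Section Linearization.
Context {R : realType} {N : nat}.
Variables (gamma : R) (m : 'I_N -> R) (x : 'cV[R]_(N * 2)).
Hypotheses (m0 : forall i, m i != 0) (xi : injective (pos x)).

Lemma Amx_mul v : massmx m *m (Amx gamma m x *m v) = dforce gamma m x v.
Proof. by rewrite /Amx -!mulmxA mulKVmx ?massmx_unit // hessian_mul. Qed.

Lemma Amx_mul_eq v w : dforce gamma m x v = massmx m *m w -> Amx gamma m x *m v = w.
Proof.
move=> vw; rewrite -[LHS](mulKmx (massmx_unit m0)) Amx_mul vw.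
by rewrite mulKmx // massmx_unit.
Qed.

Lemma pos_Amx v i : pos (Amx gamma m x *m v) i = \sum_j m j *:
  (psi gamma (sqdist x i j) *: dpos v i j +
   (2 * dpsi gamma (sqdist x i j) * dot (dpos x i j) (dpos v i j)) *: dpos x i j).
Proof.
apply: (@scalerI _ _ (m i)) => //.
rewrite -pos_massmx Amx_mul pos_of_pos scaler_sumr; apply: eq_bigr => j _.
by rewrite scalerA.
Qed.

(** [A] is built from masses, differences of positions and their dot products. Those at [i, j]
    correspond to those at [tau i, tau j], so it suffices to reindex the sum by [tau]. *)
Lemma Amx_actmx (tau : 'S_N) (Q : 'M[R]_2) :
  (forall p q, dot (Q *m p) (Q *m q) = dot p q) -> is_symmetry x tau Q ->
  (forall i, m (tau i) = m i) ->
  Amx gamma m x *m actmx tau Q = actmx tau Q *m Amx gamma m x.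
Proof.
move=> Qo s ms; apply: mulmx_eqP => v; apply: pos_eqP => i.
have dx j : dpos x i j = Q *m dpos x (tau i) (tau j).
  by rewrite /dpos mulmxBr -!s.
rewrite -(mulmxA (Amx gamma m x)) -(mulmxA (actmx tau Q)) pos_actmx !pos_Amx mulmx_sumr [RHS](reindex_inj (@perm_inj _ tau)).
apply: eq_bigr => j _ /=; rewrite -scalemxAr ms; congr (_ *: _).
by rewrite /sqdist dx mulmx_dpos !Qo [Q *m (_ *: _ + _)]mulmxDr -!scalemxAr.
Qed.

Lemma Amx_translation v : Amx gamma m x *m translation v = 0.
Proof.
apply: pos_eqP => i; rewrite pos_Amx big1 => [|j _].
  by apply/matrixP => k l; rewrite !mxE.
by rewrite /dpos !pos_translation subrr (dotC _ 0) dot0l mulr0 scale0r scaler0 addr0 scaler0.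
Qed.

Section Equilibrium.
Variable omega : R.
Hypothesis xeq : relative_equilibrium gamma omega m x.
Let kappa : R := if gamma == -1 then - omega else omega ^+ 2.

Lemma force_equilibrium : force gamma m x = kappa *: (massmx m *m x).
Proof. by rewrite -gradient_potential. Qed.

(* The force is homogeneous of degree 2 gamma + 1. *)
Lemma Amx_position : Amx gamma m x *m x = ((2 * gamma + 1) * kappa) *: x.
Proof.
apply: Amx_mul_eq; rewrite -scalemxAr -scalerA -force_equilibrium.
apply: pos_eqP => i; rewrite posZ !pos_of_pos scaler_sumr; apply: eq_bigr => j _.
have [<-|ij] := eqVneq i j; first by rewrite dposii !scaler0 addr0 scaler0.
rewrite -/(sqdist x i j) -scalerDl !scalerA; congr (_ *: _).
have := mul_dpsi gamma (sqdist_gt0 xi ij).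
by move: (sqdist x i j) => u e; rewrite -[2 * _ * u]mulrA [_ * u]mulrC e; ring.
Qed.

(* The force is equivariant under rotations. *)
Lemma Amx_Jposition : Amx gamma m x *m (@Jmx R N *m x) = kappa *: (@Jmx R N *m x).
Proof.
apply: Amx_mul_eq; rewrite -scalemxAr.
have -> : kappa *: (massmx m *m (@Jmx R N *m x)) = @Jmx R N *m force gamma m x.
  rewrite force_equilibrium -scalemxAr; congr (_ *: _); apply: pos_eqP => i.
  by rewrite pos_massmx !pos_Jmx pos_massmx scalemxAr.
apply: pos_eqP => i; rewrite pos_Jmx !pos_of_pos mulmx_sumr; apply: eq_bigr => j _.
have -> : dpos (@Jmx R N *m x) i j = Jplane *m dpos x i j.
  by rewrite /dpos !pos_Jmx mulmxBr.
by rewrite dot_Jplane mulr0 scale0r addr0 scalerA scalemxAr.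
Qed.

End Equilibrium.
End Linearization.

(** * Counting the points of a ring system *)

Section RingSystem.
Context {R : realType} {n N a b c : nat}.
Variables (sigma : mx_representation R [set: Dih n]%SET 2) (x : 'cV[R]_(N * 2)).
Hypotheses (n2 : (2 < n)%N) (sigma_std : standard_representation sigma)
  (xi : injective (pos x)) (xring : ring_system sigma a b c (range (pos x))).

Lemma card_eq_finset (A : set 'I_N) (D : {set 'I_N}) k :
  (forall i, A i <-> i \in D) -> (A #= `I_k)%card -> #|D| = k.
Proof.
move=> AD Ak; have fA : finite_set A by exact: finite_finset.
rewrite -(card_fset_set Ak) cardE; apply/perm_size/uniq_perm.
- exact: enum_uniq.
- exact: finmap.fset_uniq.
- move=> i; rewrite mem_enum in_fset_set //.
  by apply/idP/idP => [/AD|]; rewrite inE // => /AD.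
Qed.

(** Taken with the identity to count all points, and with [(t == 1) * t] to count those at the
    origin. *)
Lemma sum_ring_card (f : nat -> nat) :
  (\sum_(k : 'I_a + 'I_b + 'I_c) f (@ring_card n a b c k) =
   a * f 1 + b * f n + c * f n.*2)%N.
Proof.
by rewrite !big_sumType /= !sum_nat_const !card_ord.
Qed.

(** [kappa] gives the ring containing each point. The orbit of the origin is a single point;
    conversely, a one-point ring is fixed by the rotation, whose only fixed point is the origin. *)
Lemma orbit_index : exists kappa : 'I_N -> 'I_a + 'I_b + 'I_c,
  (forall k, #|[set i | kappa i == k]%SET| = @ring_card n a b c k) /\
  (forall i, (pos x i == 0) = (@ring_card n a b c (kappa i) == 1)).
Proof.
have [_ [_ _ [C [Corb Ccard Ctriv XC]]]] := xring.
have [r [s [_ rE _]]] := sigma_std.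
have /choice[kappa kC] : forall i, exists k, C k (pos x i).
  move=> i; have : (\bigcup_k C k) (pos x i) by rewrite -XC; exists i.
  by case=> k _ ?; exists k.
have kP i k : C k (pos x i) <-> kappa i = k.
  split=> [Ck|<- //].
  by apply: (Ctriv (kappa i) k) => //; exists (pos x i); split => //; exact: kC.
have Cpos k p : C k p -> exists2 i, kappa i = k & pos x i = p.
  move=> Ckp; have : (range (pos x)) p by rewrite XC; exists k.
  by case=> i _ ip; exists i => //; apply/kP; rewrite ip.
have cardk k : #|[set i | kappa i == k]%SET| = @ring_card n a b c k.
  apply: (@card_eq_finset (pos x @^-1` C k)) => [i|].
    by rewrite inE; split=> [/kP ->|/eqP/kP//]; rewrite eqxx.
  apply: card_eq_trans (Ccard k).
  have CE : C k = pos x @` (pos x @^-1` C k).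
    apply/seteqP; split=> [p|_ [i ? <-]//] /Cpos[i ki <-].
    by exists i => //; exact/kP.
  by rewrite {2}CE card_eq_sym; apply: inj_card_eq => u v _ _; exact: xi.
exists kappa; split=> // i; apply/eqP/eqP => [pi0|k1].
  have [p Cp] := Corb (kappa i).
  have p0 : p = 0.
    have : C (kappa i) (pos x i) by exact: kC.
    rewrite Cp => -[g _]; rewrite pi0 => /(congr1 (mulmx (invmx (sigma g)))).
    by rewrite mulKmx ?mulmx0 // repr_mx_unit // inE.
  have : (#|[set j | kappa j == kappa i]%SET| <= 1)%N.
    apply/card_le1_eqP => j1 j2; rewrite !inE => /eqP j1k /eqP j2k; apply: xi.
    have z j : kappa j = kappa i -> pos x j = 0.
      by move/kP; rewrite Cp => -[g _ <-]; rewrite p0 mulmx0.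
    by rewrite !z.
  by rewrite cardk /ring_card; case: (kappa i) => [[]|] _ //=; lia.
have : #|[set j | kappa j == kappa i]%SET| = 1 by rewrite cardk.
move/eqP/cards1P => [j jE].
have only q : C (kappa i) q -> q = pos x i.
  case/Cpos => l lk <-.
  have : l \in [set j | kappa j == kappa i]%SET by rewrite inE lk.
  have : i \in [set j | kappa j == kappa i]%SET by rewrite inE.
  by rewrite jE !inE => /eqP -> /eqP ->.
apply: (@rotation_fix R (2 * pi / n%:R)).
  by have := @cos_angle_neq1 R n 1; rewrite mul1r; apply; lia.
apply: only; have := kC i; have [p ->] := Corb (kappa i).
case=> g _ <-; exists (r * g)%g => //.
by rewrite repr_mxM ?inE // -mulmxA rE.
Qed.

Lemma ring_system_card : N = (a + n * (b + 2 * c))%N.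
Proof.
have [kappa [kc _]] := orbit_index.
have := sum_ring_card id; rewrite (eq_bigr (fun k => #|[set i | kappa i == k]%SET|)) //.
under eq_bigr => k _ do rewrite -sum1dep_card.
rewrite -(@partition_big _ _ _ _ _ _ xpredT kappa xpredT) //= sum1_card card_ord; lia.
Qed.

Lemma card_pos0 : #|[set i | pos x i == 0]%SET| = a.
Proof.
have [kappa [kc k0]] := orbit_index.
have := sum_ring_card (fun t => (t == 1) * t)%N.
have -> : (n == 1) = false by lia.
have -> : (n.*2 == 1) = false by lia.
rewrite /= !muln0 !addn0 !muln1 => <-.
rewrite -sum1dep_card big_mkcond (partition_big kappa xpredT) //=.
apply: eq_bigr => k _; rewrite -{2}kc -sum1dep_card big_distrr /=.
by apply: eq_bigr => i /eqP ki; rewrite muln1 k0 ki; case: eqP.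
Qed.

End RingSystem.

(** * Translations, similarities and the symmetries induced on the indices *)

Section SpecialSubspaces.
Context {R : realType} {N : nat}.
Implicit Types (u v w x : 'cV[R]_(N * 2)) (F : 'M[R]_(N * 2)).

Definition translation_mx : 'M[R]_(N * 2, 2) :=
  \matrix_(k, l) ((mxtens_unindex k).2 == l)%:R.

Lemma translation_mxE (v : 'cV[R]_2) : translation_mx *m v = translation v.
Proof.
apply/matrixP => k l; rewrite ord1 !mxE (bigD1 (mxtens_unindex k).2) //= big1 => [|j jk].
  by rewrite mxE eqxx mul1r addr0.
by rewrite mxE eq_sym (negbTE jk) mul0r.
Qed.

Definition translations : {vspace 'cV[R]_(N * 2)} := limg (linfun (mulmx translation_mx)).

Lemma mem_translations u : u \in translations <-> exists v : 'cV[R]_2, u = translation v.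
Proof.
split=> [/memv_imgP[v _ ->]|[v ->]].
  by exists v; rewrite lfunE /= translation_mxE.
by rewrite -translation_mxE -(lfunE (mulmx translation_mx)) memv_img ?memvf.
Qed.

Lemma dim_translations : (0 < N)%N -> \dim translations = 2.
Proof.
move=> N0; rewrite limg_dim_eq; first by rewrite dimvf /dim /= muln1.
apply/eqP; rewrite -subv0; apply/subvP => v; rewrite memv_cap memv_ker memvf /=.
rewrite lfunE /= translation_mxE => /eqP v0; rewrite memv0; apply/eqP.
rewrite -(pos_translation v (Ordinal N0)) v0.
by apply/matrixP => k l; rewrite !mxE.
Qed.

Lemma translations_stable F (Q : 'M[R]_2) :
  (forall v : 'cV[R]_2, F *m translation v = translation (Q *m v)) -> invariant F translations.
Proof.
move=> FQ v /mem_translations[w ->]; rewrite FQ.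
by apply/mem_translations; exists (Q *m w).
Qed.

(** With [J] as complex structure this is the complex line through [x]: the infinitesimal dilations
    and rotations of the configuration. *)
Definition similarities x : {vspace 'cV[R]_(N * 2)} := <<[:: x; @Jmx R N *m x]>>%VS.

Lemma mem_similarities x u :
  u \in similarities x <-> exists p q, u = p *: x + q *: (@Jmx R N *m x).
Proof.
rewrite /similarities span_cons span_seq1; split.
  by case/memv_addP => _ /vlineP[p ->] [_ /vlineP[q ->] ->]; exists p, q.
by case=> p [q ->]; rewrite memv_add // memvZ // memv_line.
Qed.

(** As [J] has square -1, [x = p *: J x] would give [(1 + p ^ 2) *: x = 0]. *)
Lemma dim_similarities x : x != 0 -> \dim (similarities x) = 2.
Proof.
move=> x0; apply/eqP; rewrite -/(free [:: x; @Jmx R N *m x]).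
rewrite free_cons seq1_free; apply/andP; split.
  rewrite span_seq1; apply/negP => /vlineP[p xp].
  have : (1 + p ^+ 2) *: x = 0.
    rewrite scalerDl scale1r expr2 -scalerA.
    have -> : p *: x = - (@Jmx R N *m x).
      rewrite {2}xp -scalemxAr mulmxA Jmx2 mulNmx mul1mx scalerN opprK //.
    by rewrite scalerN -xp subrr.
  move/eqP; rewrite scaler_eq0 (negbTE x0) orbF => /eqP h.
  by have := sqr_ge0 p; lra.
apply: contra x0 => /eqP Jx; rewrite -oppr_eq0 -[x]mul1mx -mulNmx -Jmx2 -mulmxA Jx.
by rewrite mulmx0.
Qed.

Lemma similarities_stable x F p q p' q' :
  F *m x = p *: x + q *: (@Jmx R N *m x) ->
  F *m (@Jmx R N *m x) = p' *: x + q' *: (@Jmx R N *m x) ->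
  invariant F (similarities x).
Proof.
move=> Fx FJ v /mem_similarities[s [t ->]]; apply/mem_similarities.
exists (s * p + t * p'), (s * q + t * q').
by rewrite mulmxDr -!scalemxAr Fx FJ !scalerDr !scalerA addrACA -!scalerDl.
Qed.

Lemma exists_symmetry n (sigma : mx_representation R [set: Dih n]%SET 2)
    (m : 'I_N -> R) x g :
  injective (pos x) -> dihedral_symmetric sigma (range (pos x)) ->
  symmetric_masses sigma x m ->
  exists tau : 'S_N, is_symmetry x tau (sigma g) /\ forall i, m (tau i) = m i.
Proof.
move=> xi xs ms.
have /choice[f fP] : forall i, exists j, pos x i = sigma g *m pos x j.
  move=> i; have : range (pos x) (pos x i) by exists i.
  by rewrite -(xs g) => -[_ [j _ <-] <-]; exists j.
have f_inj : injective f by move=> i j fij; apply: xi; rewrite fP fij -fP.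
exists (perm f_inj); split=> i; rewrite permE //.
exact/esym/(ms g)/esym/fP.
Qed.

(** An index fixed by [tau ^ j] is that of a point fixed by a nontrivial rotation, hence of a point
    at the origin. *)
Lemma mxtrace_rotationX n (tau : 'S_N) x a j : (0 < n)%N -> injective (pos x) ->
  is_symmetry x tau (rotation (angle n)) -> #|[set i | pos x i == 0]%SET| = a ->
  (0 < j < n)%N ->
  \tr (actmx tau (rotation (angle n)) ^+ j) = a%:R * (2 * cos (j%:R * angle n)) :> R.
Proof.
move=> n0 xi s <- jn.
have sj := is_symmetryX j s; rewrite rotationX in sj.
rewrite actmxX rotationX mxtrace_actmx tr_rotation; congr (_%:R * _).
apply: eq_card => i; rewrite !inE; apply/eqP/eqP => [ti|pi0].
  apply: (@rotation_fix R (j%:R * angle n)); first exact: cos_angle_neq1.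
  by rewrite {2}sj ti.
apply: xi; rewrite pi0; have := sj i; rewrite pi0.
move/(congr1 (mulmx (rotation (- (j%:R * angle n))))).
by rewrite mulmx0 mulmxA rotationD addNr rotation0 mul1mx.
Qed.

End SpecialSubspaces.

Lemma cyc_space_fix (R : realType) n d (G : 'M[R]_d) (v : 'cV[R]_d) :
  G *m v = v -> v \in cyc_space n G 0.
Proof.
move=> Gv; have Gk k : G ^+ k *m v = v.
  elim: k => [|k IH]; first by rewrite expr0 mul1mx.
  by rewrite exprS -[G * _]/(G *m _) -mulmxA IH.
rewrite mem_cyc_space /cyc_sum mulmxDl Gv Gk /cyc_eig mul0r cos0 mulr1.
by rewrite scaler_nat mulr2n.
Qed.

(** On translations [G] acts as the plane rotation, and a rotation plus its inverse is the scalar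
    [2 * cos]. *)
Lemma translations_sub (R : realType) n N (tau : 'S_N) : (2 < n)%N ->
  (@translations R N <= cyc_space n (actmx tau (rotation (angle n))) 1)%VS.
Proof.
move=> n2; apply/subvP => _ /mem_translations[v ->].
rewrite mem_cyc_space /cyc_sum mulmxDl actmxX rotationX !actmx_translation.
have n0 : (0 < n)%N by exact: ltn_trans n2.
have -> : n.-1%:R * angle n = 2 * pi + - angle n :> R.
  by rewrite -subn1 natrB // mulrBl mul1r natr_angle.
rewrite -rotationD rotation_2pi mul1mx /cyc_eig mul1r.
apply/eqP/pos_eqP => i; rewrite posD posZ !pos_translation -mulmxDl.
have -> : rotation (angle n) + rotation (- angle n) = (2 * cos (angle n))%:M :> 'M[R]_2.
  rewrite /rotation mx2D cosN sinN -scalemx1 -mx2_1.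
  by apply: mx2_eq; rewrite !mxE /=; ring.
by rewrite mul_scalar_mx.
Qed.

(** * Assembly of the factorization *)

Unset Implicit Arguments.
Set Strict Implicit.
Set Printing Implicit Defensive.

Theorem mainTheorem1 (R : realType) (n N a b c : nat) (gamma omega : R)
    (sigma : mx_representation R [set: Dih n]%SET 2)
    (m : 'I_N -> R) (x : 'cV[R]_(N * 2)) :
  (2 < n)%N ->
  omega != 0 ->
  standard_representation sigma ->
  (forall i, m i != 0) ->
  injective (pos x) ->
  dihedral_symmetric sigma (range (pos x)) ->
  symmetric_masses sigma x m ->
  ring_system sigma a b c (range (pos x)) ->
  relative_equilibrium gamma omega m x ->
  let A := Amx gamma m x in
  let J := @Jmx R N in
  let factor := invariant_factor gamma omega A J in
  let detr := restricted_poly gamma omega A J in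
  exists
    (V : 'I_(if odd n then 1 else 2)%N -> {vspace 'cV[R]_(N * 2)})
    (W : 'I_(if odd n then (n - 3)./2 else n./2 - 2)%N
         -> {vspace 'cV[R]_(N * 2)})
    (Z : {vspace 'cV[R]_(N * 2)})
    (qV : 'I_(if odd n then 1 else 2)%N -> {poly R})
    (qW : 'I_(if odd n then (n - 3)./2 else n./2 - 2)%N -> {poly R})
    (qZ : {poly R}),
  [/\ directv (\sum_i V i + \sum_j W j + Z)%VS,
      (\sum_i V i + \sum_j W j + Z)%VS = fullv
    & stability_poly gamma omega A J
        = \prod_i detr (V i) * \prod_j detr (W j) * detr Z] /\
  [/\ forall i, factor (V i) (2 * (b + 2 * c))%N (qV i),
      forall j, factor (W j) (4 * (b + 2 * c))%N (qW j)
    & factor Z (2 * (a + 2 * b + 4 * c))%N qZ] /\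
  (exists (T : {vspace 'cV[R]_(N * 2)}) (q : {poly R}),
     [/\ forall u, u \in T <-> exists v, u = translation v,
         (T <= Z)%VS, factor T 2%N q & q %| qZ]) /\
  (exists i q,
     let K := <<[:: x; J *m x]>>%VS in
     [/\ (K <= V i)%VS, factor K 2%N q & q %| qV i]).
Proof.
move=> n2 om0 sigma_std m0 xi xs ms xring xeq A J factor detr.
have n0 : (0 < n)%N by exact: ltn_trans n2.
have [r [s [_ rE [t sE]]]] := sigma_std.
have [_ [_ bc0 _]] := xring.
have [taur [symr mr]] := exists_symmetry r xi xs ms.
have [taus [syms msym]] := exists_symmetry s xi xs ms.
rewrite rE -/(angle n) in symr; rewrite sE in syms.
pose G := actmx taur (rotation (angle n)) : 'M[R]_(N * 2).
pose F := actmx taus (reflection t) : 'M[R]_(N * 2).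
(* The dihedral relations are checked on the plane matrices and lifted to [G] and [F]. *)
have Gn : G ^+ n = 1.
  have := is_symmetryX n symr; rewrite /G actmxX rotationX natr_angle // rotation_2pi.
  exact: symmetry_actmx1.
have FF : F *m F = 1%:M.
  have := is_symmetryM syms syms; rewrite /F actmxM reflection2.
  exact: symmetry_actmx1.
have FG : F *m G *m F *m G = 1%:M.
  have := is_symmetryM (is_symmetryM (is_symmetryM syms symr) syms) symr.
  rewrite /F /G !actmxM reflection_rotation; exact: symmetry_actmx1.
have AG : A *m G = G *m A by apply: Amx_actmx => //; exact: dot_rotation.
have AF : A *m F = F *m A by apply: Amx_actmx => //; exact: dot_reflection.
have JG : J *m G = G *m J by apply/Jmx_actmx/rotationJ.
have JF : J *m F = - (F *m J) by apply/Jmx_actmxN/reflectionJ.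
have JJ : J *m J = - 1%:M := Jmx2.
(* The number of free orbits of points under the rotation: one for each regular n-gon, two for each
   semiregular 2n-gon. *)
pose q := (b + 2 * c)%N.
have NE : N = (a + n * q)%N by exact: ring_system_card xring.
have dE : (N * 2 = 2 * (a + n * q))%N by rewrite mulnC NE.
have a0 := card_pos0 n2 sigma_std xi xring.
have trG j : (0 < j < n)%N -> \tr (G ^+ j) = a%:R * (2 * cos (j%:R * angle n)).
  exact: mxtrace_rotationX a0.
pose U l := cyc_space n G l.
have dimU l := dim_cyc_space n2 dE Gn trG (l := l).
have AU l : invariant A (U l) by exact: cyc_space_stable.
have JU l : invariant J (U l) by exact: cyc_space_stable.
have FU l : invariant F (U l) by exact: cyc_space_stable_inv.
have facts W : invariant A W -> invariant J W -> invariant F W ->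
    exists p, factor W (\dim W) p.
  by move=> AW JW FW; exact: invariant_factor_exists AW JW FW JJ FF AF JF.
pose V (i : 'I_(if odd n then 1 else 2)%N) := U (simple_index n i).
pose W (j : 'I_(if odd n then (n - 3)./2 else n./2 - 2)%N) := U j.+2.
pose Z := U 1%N.
have dimV i : \dim (V i) = (2 * q)%N.
  rewrite dimU /simple_index; last by case: ifP.
  move: (ltn_ord i); move: (nat_of_ord i) => k; case: (boolP (odd n)) => on k2.
    by have -> : k = 0%N by lia.
  have [//|_] := eqVneq k 0%N.
  have -> : n./2.*2 == n by apply/eqP; lia.
  by rewrite orbT.
have dimW j : \dim (W j) = (4 * q)%N.
  have j2 : (j.+2 <= n./2)%N /\ (j.+2).*2 != n.
    by move: (ltn_ord j); move: (nat_of_ord j) => k; case: (boolP (odd n)) => on kn; split; lia.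
  by rewrite dimU; [case: ifP; lia | case: j2].
have dimZ : \dim Z = (2 * (a + 2 * q))%N.
  by rewrite dimU; [case: ifP; lia | lia].
have sumU : (\sum_i V i + \sum_j W j + Z)%VS = fullv.
  rewrite -(sum_cyc_space n2 Gn).
  exact: (@big_cyc_index _ _ (@addv R _) n U n2).
(* The dimensions add up to [N * 2]. This makes the sum direct, both in the grouping by [V], [W],
   [Z] and in the indexing by [l]. *)
have sumdim : (\sum_i \dim (V i) + \sum_j \dim (W j) + \dim Z = N * 2)%N.
  under eq_bigr => i _ do rewrite dimV.
  under [X in (_ + X + _)%N]eq_bigr => i _ do rewrite dimW.
  rewrite !sum_nat_const !card_ord dimZ dE; case: (boolP (odd n)) => on.
    have -> : (n * q = 2 * ((n - 3)./2 * q) + 3 * q)%N.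
      by rewrite mulnA -mulnDl; congr (_ * _)%N; lia.
    by move: ((n - 3)./2) => w; lia.
  have -> : (n * q = 2 * ((n./2 - 2) * q) + 4 * q)%N.
    by rewrite mulnA -mulnDl; congr (_ * _)%N; lia.
  by move: (n./2 - 2)%N => w; lia.
have dimT : \dim (fullv : {vspace 'cV[R]_(N * 2)}) = (N * 2)%N.
  by rewrite dimvf /dim /= muln1.
have dimsum : \dim (\sum_(l < n./2.+1) U l) = (\sum_(l < n./2.+1) \dim (U l))%N.
  rewrite (sum_cyc_space n2 Gn) dimT; apply: etrans (esym sumdim) _.
  exact: (@big_cyc_index _ _ addn n (fun l => \dim (U l)) n2).
have /choice[fV fVP] i : exists p, factor (V i) (2 * q)%N p.
  by rewrite -(dimV i); exact: facts (AU _) (JU _) (FU _).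
have /choice[fW fWP] j : exists p, factor (W j) (4 * q)%N p.
  by rewrite -(dimW j); exact: facts (AU _) (JU _) (FU _).
have [fZ fZP] := facts Z (AU _) (JU _) (FU _); rewrite dimZ in fZP.
exists V, W, Z, fV, fW, fZ; split; [split|split; [split|split]] => //.
- by rewrite directvE /= sumU dimT sumdim.
- rewrite /detr -restricted_poly_fullv -(sum_cyc_space n2 Gn) restricted_poly_sumv //.
  symmetry.
  exact: (@big_cyc_index _ _ *%R n (fun l => restricted_poly gamma omega A J (U l)) n2).
- by have -> : (2 * (a + 2 * b + 4 * c) = 2 * (a + 2 * q))%N by rewrite /q; lia.
- have N0 : (0 < N)%N by rewrite NE /q; nia.
  have AT : invariant A translations.
    apply: (@translations_stable _ _ _ 0) => v; rewrite Amx_translation // mul0mx.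
    by apply/matrixP => k l; rewrite !mxE.
  have JT : invariant J translations.
    apply: (@translations_stable _ _ _ Jplane) => v; apply: pos_eqP => i.
    by rewrite pos_Jmx !pos_translation.
  have FT : invariant F translations.
    by apply: translations_stable => v; exact: actmx_translation.
  have [p pP] := facts _ AT JT FT; rewrite dim_translations // in pP.
  exists translations, p; split=> //; first exact: mem_translations.
    exact: translations_sub.
  by apply: invariant_factor_dvdp pP fZP _; exact: translations_sub.
have h0 : (0 < if odd n then 1 else 2)%N by case: ifP.
have Gx : G *m x = x by exact: actmx_id.
have Fx : F *m x = x by exact: actmx_id.
(* [G] fixes [x], and also [J x] because it commutes with [J]; both lie in the eigenspace of index
   0, the first of the [V i]. *)
have KV : (similarities x <= V (Ordinal h0))%VS.
  apply/subvP => _ /mem_similarities[p1 [p2 ->]].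
  rewrite memvD // memvZ //; apply: cyc_space_fix => //.
  by rewrite mulmxA -JG -mulmxA Gx.
have x0 : x != 0.
  (* If [x] were zero all points would coincide, but [b + c > 0] and [n > 2] give at least three
     distinct points. *)
  apply/eqP => x0; have N2 : (2 < N)%N by rewrite NE /q; nia.
  have : Ordinal (ltn_trans (isT : 0 < 1)%N (ltn_trans (isT : 1 < 2)%N N2)) =
      Ordinal (ltn_trans (isT : 1 < 2)%N N2).
    by apply: xi; rewrite x0; apply/matrixP => k l; rewrite !mxE.
  by move/(congr1 val).
have AK : invariant A (similarities x).
  apply: similarities_stable.
    by rewrite (Amx_position m0 xi xeq) -[LHS]addr0 -(scale0r (J *m x)).
  by rewrite (Amx_Jposition m0 xi xeq) -[LHS]add0r -(scale0r x).
have JK : invariant J (similarities x).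
  apply: (@similarities_stable _ _ _ _ 0 1 (-1) 0).
    by rewrite scale0r scale1r add0r.
  by rewrite mulmxA JJ mulNmx mul1mx scaleN1r scale0r addr0.
have FK : invariant F (similarities x).
  (* [F] fixes [x] and, anticommuting with [J], negates [J x]. *)
  apply: (@similarities_stable _ _ _ _ 1 0 0 (-1)).
    by rewrite scale0r scale1r addr0.
  rewrite scaleN1r scale0r add0r -[in RHS]Fx mulmxA.
  by apply/eqP; rewrite -eqr_oppLR mulmxA -mulNmx -JF.
have [p pP] := facts _ AK JK FK; rewrite dim_similarities // in pP.
exists (Ordinal h0), p => K; split=> //.
exact: invariant_factor_dvdp pP (fVP _) KV.
Qed.
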